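(* (a) Let $D$ be a diagram in which every nonempty column contains exactly one cell. Then the following are equivalent: (1) $\mathcal{P}(D)$ is shellable; (2) $\mathcal{P}(D)$ is EL-shellable; (3) $D\setminus\{(1,\tilde c)\mid \tilde c>0\}$ (the diagram obtained by deleting all cells in row $1$) is a hook diagram. (b) Let $D$ be a diagram whose first two rows (rows $1$ and $2$) contain no cells. Then the following are equivalent: (1) $\mathcal{P}(D)$ is shellable; (2) $\mathcal{P}(D)$ is EL-shellable; (3) $D$ is a hook diagram.
   Context: A diagram is a finite set of cells in $\mathbb{Z}_{>0}\times\mathbb{Z}_{>0}$; a cell $(r,c)$ lies in row $r$ (rows numbered from the bottom, starting at $1$) and column $c$ (columns numbered from the left, starting at $1$). Applying a Kohnert move at row $r$ of a diagram $D$: if row $r$ is nonempty, let $(r,c)$ be its rightmost cell; if there is $r'$ with $1\le r'<r$ and $(r',c)\notin D$, take the largest such $r'$ and replace the cell $(r,c)$ by $(r',c)$ (the cell jumps over the cells between); otherwise $D$ is unchanged. $KD(D)$ denotes the set of all diagrams obtainable from $D$ by a finite (possibly empty) sequence of Kohnert moves. The Kohnert poset $\mathcal{P}(D)$ is $KD(D)$ with $D_2\preceq D_1$ iff $D_2$ can be obtained from $D_1$ by a sequence of Kohnert moves. For positive integers $r_1\le r_2$ and a finite nonempty set $C=\{c_1,\dots,c_m\}\subset\mathbb{Z}_{>0}$ with $c_m=\max C$, let $H(r_1,r_2;C)=\{(r_2,c_i)\mid 1\le i\le m\}\cup\{(j,c_m)\mid r_1\le j\le r_2\}$. A diagram $D$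 is a hook diagram if $D\in KD(H(r_1,r_2;C))$ for some such $r_1,r_2,C$. The order complex $\Delta(\mathcal{P})$ of a finite poset is the simplicial complex whose faces are the chains of $\mathcal{P}$. A simplicial complex is shellable if its facets can be ordered $F_1,\dots,F_t$ so that for each $2\le k\le t$ the complex $\left(\bigcup_{i<k}\overline{F_i}\right)\cap\overline{F_k}$ is pure of dimension $\dim F_k-1$ (here $\overline F$ is the set of all subsets of $F$, $\dim F=|F|-1$, and pure means all facets have equal dimension). A poset is shellable if its order complex is. A poset is bounded if it has a unique minimal and a unique maximal element. A bounded poset $\mathcal{P}$ is EL-shellable if there is a labeling $\lambda$ of its covering pairs $x\prec\!\!\cdot\, y$ by elements of some poset $\Lambda$ such that for every interval $[x,y]$ there is a unique saturated chain $x=x_0\prec\!\!\cdot\,x_1\prec\!\!\cdot\cdots\prec\!\!\cdot\,x_n=y$ with $\lambda(x_0,x_1)\le\cdots\le\lambda(x_{n-1},x_n)$, and its label sequence is lexicographically smaller than that of every other saturated chain from $x$ to $y$.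
   Formalization: Condition (3) is read as ''is empty or is a hook diagram'' in both parts, since the empty diagram is not a hook diagram (C is nonempty) although its Kohnert poset is a single point, hence shellable and EL-shellable. *)

(* Defs.v *)
From HB Require Import structures.
From mathcomp Require Import all_boot all_order ssralg ssrint.
From mathcomp Require Import finmap.
From mathcomp Require Import boolp.

Set Implicit Arguments.
Unset Strict Implicit.
Unset Printing Implicit Defensive.

Import Order.TTheory GRing.Theory.
Local Open Scope fset_scope.

(** * Order complexes and shellability *)

Section Complexes.
Variable T : finType.
Implicit Types (K : {set {set T}}) (F G : {set T}).

Definition facets K : {set {set T}} := [set F | maxset (fun G => G \in K) F].

Definition dim F : int := (#|F|%:Z - 1)%R.

Definition pure_of_dim K (n : int) : Prop := forall F, F \in facets K -> dim F = n.

(* Facets are indexed from 0, so [take k Fs] lists those before the [k]-th. *)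
Definition shelling K (Fs : seq {set T}) : Prop :=
  [/\ uniq Fs, Fs =i facets K &
      forall k, 0 < k < size Fs ->
        let Fk := nth set0 Fs k in
        pure_of_dim ((\bigcup_(F <- take k Fs) powerset F) :&: powerset Fk)
                    (dim Fk - 1)%R].

Definition shellable_complex K : Prop := exists Fs, shelling K Fs.

End Complexes.

Section Posets.
Context {d : Order.disp_t} (T : finPOrderType d).
Local Open Scope order_scope.

Definition order_complex : {set {set T}} :=
  [set A : {set T} | [forall x in A, forall y in A, x >=< y]].

Definition shellable : Prop := shellable_complex order_complex.

Definition minimal (x : T) : Prop := forall y : T, y <= x -> y = x.
Definition maximal (x : T) : Prop := forall y : T, x <= y -> y = x.

Definition bounded : Prop :=
  (exists! x : T, minimal x) /\ (exists! x : T, maximal x).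

Definition covered (x y : T) : bool :=
  (x < y) && ~~ [exists z : T, (x < z) && (z < y)].

(* The saturated chain is x followed by the elements of p. *)
Definition saturated_chain (x y : T) (p : seq T) : Prop :=
  path covered x p /\ last x p = y.

(* [lam] is only ever evaluated on covering pairs.  In the lexicographic order
   of [seqlexi L], a proper prefix is smaller. *)
Definition EL_labeling {d' : Order.disp_t} (L : porderType d') (lam : T -> T -> L)
    : Prop :=
  let labels x p : seqlexi L := pairmap lam x p in
  forall x y : T, x <= y ->
  exists p : seq T,
    [/\ saturated_chain x y p /\ sorted <=%O (labels x p : seq L),
        forall q, saturated_chain x y q -> sorted <=%O (labels x q : seq L) ->
          q = p &
        forall q, saturated_chain x y q -> q <> p -> labels x p < labels x q].

Definition EL_shellable : Prop :=
  bounded /\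
  exists (d' : Order.disp_t) (L : porderType d') (lam : T -> T -> L),
    EL_labeling lam.

End Posets.

(** * Diagrams and Kohnert moves *)

(* Finite sets of cells (row, column). *)
Notation cells := {fset nat * nat}.

Definition diagram (D : cells) : Prop :=
  forall x, x \in D -> 0 < x.1 /\ 0 < x.2.

Definition row_of (D : cells) (r : nat) : cells := [fset x in D | x.1 == r].
Definition column_of (D : cells) (c : nat) : cells := [fset x in D | x.2 == c].

(* An empty [\max] is 0: [r' = 0] says that there is no free position below
   (r, c). *)
Definition kohnert_move (D : cells) (r : nat) : cells :=
  if row_of D r == fset0 then D else
  let c := \max_(x <- row_of D r) x.2 in
  let r' := \max_(1 <= i < r | (i, c) \notin D) i in
  if r' == 0 then D else (r', c) |` (D `\ (r, c)).

Definition KD (D : cells) : {pred cells} :=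
  [pred E | `[< exists rs : seq nat, E = foldl kohnert_move D rs >]].

(** * The poset of Kohnert diagrams *)

Lemma KDP D E :
  reflect (exists rs : seq nat, E = foldl kohnert_move D rs) (E \in KD D).
Proof. exact: asboolP. Qed.

Lemma kohnert_move_spec D r : kohnert_move D r = D \/
  exists r' c, [/\ r' < r, (r, c) \in D, (r', c) \notin D
                 & kohnert_move D r = (r', c) |` (D `\ (r, c))].
Proof.
rewrite /kohnert_move; case: eqP => [_|/eqP/fset0Pn[y yr]]; first by left.
set c := \max_(x <- _) x.2; set r' := \max_(1 <= i < r | _) i.
case: eqP => [_|/eqP r'0]; [by left | right; exists r', c].
have rD : (r, c) \in D.
  have [x xr cE] : exists2 x, x \in row_of D r & c = x.2.
    have : has predT (enum_fset (row_of D r)) by apply/hasP; exists y.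
    have sub : {subset enum_fset (row_of D r) <= row_of D r} by [].
    rewrite /c; elim: (enum_fset (row_of D r)) sub => //= a s IHs sub _.
    rewrite big_cons; have [h|h] := boolP (has predT s).
      have [|z zr ->] := IHs _ h.
        by move=> w ws; apply: sub; rewrite inE ws orbT.
      have [_|_] := leqP a.2 z.2; first by exists z.
      by exists a => //; apply: sub; rewrite mem_head.
    case: s h {IHs} sub => // _ sub; rewrite big_nil maxn0.
    by exists a => //; apply: sub; rewrite mem_head.
  by move: xr; rewrite cE !inE => /andP[xD /eqP <-]; rewrite -surjective_pairing.
have [lt_r' r'D] : r' < r /\ (r', c) \notin D.
  move: r'0; rewrite /r' big_nat_cond.
  elim/big_ind: _ => [//|m n IHm IHn|i /andP[/andP[_ ?] ?] _ //].
  by rewrite /maxn; case: ifP => _; [exact: IHn|exact: IHm].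
by [].
Qed.

Lemma sum_rows_kohnert_move D r : kohnert_move D r = D \/
  \sum_(x <- kohnert_move D r) x.1 < \sum_(x <- D) x.1.
Proof.
have [->|[r' [c [lt_r' rD r'D ->]]]] := kohnert_move_spec D r; first by left.
right; rewrite (big_fsetD1 (r, c) rD) /= big_fsetU1 /=; last first.
  by rewrite !inE negb_and r'D orbT.
by rewrite ltn_add2r.
Qed.

Lemma sum_rows_KD D E : E \in KD D ->
  E = D \/ \sum_(x <- E) x.1 < \sum_(x <- D) x.1.
Proof.
case/KDP=> rs ->; elim: rs D => [|r rs IHrs] D /=; first by left.
have := IHrs (kohnert_move D r).
case: (sum_rows_kohnert_move D r) => [->|lt1] //.
by case=> [->|lt2]; right; rewrite ?lt1 // (ltn_trans lt2 lt1).
Qed.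

Lemma KD_refl D : D \in KD D.
Proof. by apply/KDP; exists [::]. Qed.

Lemma KD_trans D E F : E \in KD D -> F \in KD E -> F \in KD D.
Proof.
move=> /KDP[rs ->] /KDP[rs' ->]; apply/KDP.
by exists (rs ++ rs'); rewrite foldl_cat.
Qed.

Lemma KD_anti D E : E \in KD D -> D \in KD E -> D = E.
Proof.
move=> /sum_rows_KD[->//|lt1] /sum_rows_KD[//|lt2].
by have := ltn_trans lt1 lt2; rewrite ltnn.
Qed.

(* All positions weakly below the cells of D. *)
Definition shadow (D : cells) : cells :=
  [fset z in flatten [seq [seq (i, x.2) | i <- iota 0 x.1.+1] | x <- D]].

Lemma shadowP D y :
  reflect (exists2 x, x \in D & y.1 <= x.1 /\ y.2 = x.2) (y \in shadow D).
Proof.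
rewrite !inE; apply: (iffP flatten_mapP) => [[x xD /mapP[i]]|[x xD [le_yx eq_yx]]].
  by rewrite mem_iota add0n ltnS => /= le_ix ->; exists x.
exists x => //; apply/mapP; exists y.1; first by rewrite mem_iota add0n ltnS.
by rewrite -eq_yx -surjective_pairing.
Qed.

Lemma KD_shadow D E : E \in KD D -> E `<=` shadow D.
Proof.
case/KDP=> rs ->; elim/last_ind: rs => [|rs r IHrs].
  by apply/fsubsetP => x xD; apply/shadowP; exists x.
rewrite foldl_rcons; set F := foldl _ _ _ in IHrs *.
have [->//|[r' [c [lt_r' rF _ ->]]]] := kohnert_move_spec F r.
apply/fsubsetP => x; rewrite in_fset1U in_fsetD1 => /orP[/eqP->|/andP[_ xF]].
  have /shadowP[z zD /= [le_rz cE]] := fsubsetP IHrs _ rF.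
  by apply/shadowP; exists z => //=; rewrite cE (leq_trans (ltnW lt_r')).
exact: (fsubsetP IHrs).
Qed.

Definition kohnert_poset (D : cells) : Type := {E : cells | E \in KD D}.

Section KohnertPoset.
Variable D : cells.
Local Notation P := (kohnert_poset D).

HB.instance Definition _ := Countable.on P.
HB.instance Definition _ := SubChoice.on P.

Definition kohnert_enum : seq P := pmap insub (enum_fset (fpowerset (shadow D))).

Lemma kohnert_enumP : Finite.axiom kohnert_enum.
Proof.
apply: Finite.uniq_enumP => [|E]; first by rewrite pmap_sub_uniq ?fset_uniq.
by rewrite mem_pmap_sub inE fpowersetE KD_shadow // (valP E).
Qed.

HB.instance Definition _ := isFinite.Build P kohnert_enumP.

Definition kohnert_le (E F : P) : bool := val E \in KD (val F).

Lemma kohnert_le_refl : reflexive kohnert_le.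
Proof. by move=> E; exact: KD_refl. Qed.

Lemma kohnert_le_anti : antisymmetric kohnert_le.
Proof. by move=> E F /andP[EF FE]; apply/val_inj/(KD_anti FE EF). Qed.

Lemma kohnert_le_trans : transitive kohnert_le.
Proof. by move=> F E G EF FG; apply: KD_trans FG EF. Qed.

HB.instance Definition _ := Order.Le_isPOrder.Build (Order.Disp tt tt) P
  kohnert_le_refl kohnert_le_anti kohnert_le_trans.

End KohnertPoset.

(** * Hook diagrams *)

Definition hook (r1 r2 : nat) (C : {fset nat}) : cells :=
  [fset (r2, c) | c in C] `|`
  [fset (j, \max_(c <- C) c) | j in index_iota r1 r2.+1].

(* Since C is nonempty, the empty set of cells is not a hook diagram; its Kohnert
   poset is nevertheless a single point, hence EL-shellable. *)
Definition hook_diagram (D : cells) : Prop :=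
  exists (r1 r2 : nat) (C : {fset nat}),
    [/\ 0 < r1 <= r2, C != fset0, forall c, c \in C -> 0 < c
      & D \in KD (hook r1 r2 C)].

(* Main.v *)
Require Import Defs.
From mathcomp Require Import all_boot all_order finmap.
From mathcomp Require Import ssralg ssrint boolp zify.

(** Every diagram reachable from a hook is described by the rows of its cells,
    listed from left to right and then down the last column; these sequences are
    weakly decreasing (strictly on the last column), and reachability is the
    componentwise order, since a jump over k cells is a composite of k + 1 steps
    of length one.  So the poset of a hook diagram is a distributive lattice:
    labelling a cover by the coordinate it raises is an EL-labelling, and maximal
    chains ordered by a weight that drops when a descent is swapped out form a
    shelling.

    If D is not a hook diagram, either two cells form an ascent (the right one
    strictly higher), or some column with two cells is not the last one; in the
    latter case the upper of its two lowest cells can jump over the lower one and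
    create an ascent.  Using the free positions in the lowest rows to clear the
    rows around an ascent, one reaches a diagram with a cell in row r of column c
    and a cell in row r + 1 of a column c' > c.  The interval below it in which
    both drop to row r - 1 is a hexagon: when the right cell is in row r it blocks
    the left one.  Both maximal chains of a hexagon would have to be increasing for
    an EL-labelling, and two facets that differ only by rerouting across the
    hexagon cannot be ordered in a shelling. *)

Set Implicit Arguments.
Unset Strict Implicit.
Unset Printing Implicit Defensive.

Import Order.TTheory.
Local Open Scope fset_scope.
Local Open Scope nat_scope.

(** * Shellings and hexagons *)

Section ShellingCriterion.
Variable T : finType.
Implicit Types (K : {set {set T}}) (F G H : {set T}).

(** Listing the facets by increasing [W] is a shelling. A face shared by [G] and an earlier [F]
    avoids [v], so it lies in the codimension-one face [G :\ v], which [G] shares with the strictly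
    lighter, hence earlier, [H]. Since the hypothesis also covers [W F = W G], ties may be broken
    arbitrarily. *)
Lemma shellable_of_weight K (W : {set T} -> nat) :
  (forall F G, F \in facets K -> G \in facets K -> F <> G -> W F <= W G ->
    exists H v, [/\ H \in facets K, W H < W G, v \in G,
                    v \notin F & G :\ v \subset H]) ->
  shellable_complex K.
Proof.
move=> hW; pose leW F G := W F <= W G.
pose Fs := sort leW (enum (facets K)).
have leW_tr : transitive leW by move=> x y z; exact: leq_trans.
have leW_refl : reflexive leW by move=> x; exact: leqnn.
have srt : sorted leW Fs by apply: sort_sorted => x y; exact: leq_total.
have memFs F : (F \in Fs) = (F \in facets K) by rewrite mem_sort mem_enum.
exists Fs; split; [by rewrite sort_uniq enum_uniq | exact: memFs |].
move=> k /andP[_ ltk] Fk A; rewrite inE => /maxsetP[].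
have FkK : Fk \in facets K by rewrite -memFs mem_nth.
rewrite inE bigcup_seq => /andP[/bigcupP[F Fin AF] AFk] Amax.
have [FK leF] : F \in facets K /\ W F <= W Fk.
  split; first by rewrite -memFs (mem_take Fin).
  have [i lti <-] : exists2 i, i < k & nth set0 Fs i = F.
    have lti : index F (take k Fs) < k.
      by rewrite (leq_trans _ (geq_minl k (size Fs))) // -size_take_min index_mem.
    by exists (index F (take k Fs)); rewrite // -(nth_take set0 lti) nth_index.
  by apply: (sorted_leq_nth leW_tr leW_refl set0 srt); rewrite ?inE //; lia.
have neF : F <> Fk.
  move=> FE; move: Fin; rewrite FE => /nthP-/(_ set0)[i].
  rewrite size_takel ?(ltnW ltk) // => lti; rewrite nth_take // => /eqP.
  have us : uniq Fs by rewrite sort_uniq enum_uniq.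
  by rewrite (nth_uniq set0) ?(ltn_trans lti) // (ltn_eqF lti).
have [H [v [HK ltH vk vF sub]]] := hW _ _ FK FkK neF leF.
have Hin : H \in take k Fs.
  have HFs : H \in Fs by rewrite memFs.
  have lti : index H Fs < k.
    rewrite ltnNge; apply/negP => lei.
    have : leW Fk (nth set0 Fs (index H Fs)).
      by apply: (sorted_leq_nth leW_tr leW_refl set0 srt); rewrite ?inE ?index_mem.
    by rewrite nth_index // /leW leqNgt ltH.
  rewrite -(nth_index set0 HFs) -(nth_take set0 lti).
  by apply: mem_nth; rewrite size_takel // ltnW.
have AE : Fk :\ v = A.
  apply: Amax.
    rewrite inE; apply/andP; split.
      by apply/bigcupP; exists H => //; rewrite inE.
    by rewrite inE subD1set.
  apply/subsetP => u uA; rewrite !inE in AF AFk *; rewrite (subsetP AFk) // andbT.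
  by apply: contraNneq vF => <-; exact: (subsetP AF).
by rewrite /dim -AE (cardsD1 v Fk) vk PoszD [(1%:Z + _)%R]GRing.addrC GRing.addrK.
Qed.

(** Let [G] be the later of the two. A maximal face of the intersection with earlier facets that
    contains [F :&: G] comes from an earlier facet containing [F :&: G], and that facet can only be
    [F]. The maximal face is then [F :&: G] itself, of codimension at least two in [G]. *)
Lemma not_shellable_two_facets K F G :
  F \in facets K -> G \in facets K ->
  (forall H, H \in facets K -> F :&: G \subset H -> H = F \/ H = G) ->
  1 < #|F :\: G| -> 1 < #|G :\: F| -> ~ shellable_complex K.
Proof.
move=> FK GK only cFG cGF [Fs [us memFs shFs]].
wlog lt_FG : F G FK GK only cFG cGF / index F Fs < index G Fs.
  move=> hw; case: (ltngtP (index F Fs) (index G Fs)) => [||eqi].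
  - exact: (hw F G).
  - apply: (hw G F) => // H HK; rewrite setIC => /(only H HK)[]; by [right|left].
  - have FG : F = G by rewrite -(nth_index set0 (_ : F \in Fs)) ?eqi ?nth_index ?memFs.
    by move: cFG; rewrite FG setDv cards0.
have FFs : F \in Fs by rewrite memFs.
have GFs : G \in Fs by rewrite memFs.
have ltG : index G Fs < size Fs by rewrite index_mem.
have /shFs : 0 < index G Fs < size Fs by rewrite ltG (leq_ltn_trans _ lt_FG).
rewrite nth_index //=.
set K' := _ :&: _ => pureK'.
have Fin : F \in take (index G Fs) Fs.
  rewrite -(nth_index set0 FFs) -(nth_take set0 lt_FG).
  by apply: mem_nth; rewrite size_takel // ltnW.
have FGK' : F :&: G \in K'.
  rewrite in_setI bigcup_seq !powersetE subsetIr andbT.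
  by apply/bigcupP; exists F => //; rewrite powersetE subsetIl.
(* Purity speaks only of maximal faces, so [F :&: G] is first enlarged to one. *)
have [A Amax subA] := maxset_exists FGK'.
have /pureK' : A \in facets K' by rewrite inE.
have [AK' _] := maxsetP Amax; have : A \in K' by [].
rewrite in_setI bigcup_seq => /andP[/bigcupP[H Hin]].
rewrite !powersetE => AH AG.
have HK : H \in facets K by rewrite -memFs (mem_take Hin).
have HG : H <> G.
  move=> HE; move: Hin; rewrite HE => /nthP-/(_ set0)[i].
  rewrite size_takel ?(ltnW ltG) // => lti; rewrite nth_take // => /eqP.
  by rewrite -[X in _ == X](nth_index set0 GFs) (nth_uniq set0) ?(ltn_trans lti) // (ltn_eqF lti).
have [HF|//] := only H HK (subset_trans subA AH).
have -> : A = G :&: F.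
  by apply/eqP; rewrite eqEsubset subsetI AG -HF AH HF setIC subA.
by move: cGF; rewrite /dim -(cardsID F G); move: #|_| #|_| => m n; clear; lia.
Qed.

End ShellingCriterion.

(** * Maximal chains, labels of rank-two intervals, and hexagons as obstructions *)

Section OrderComplex.
Context {d : Order.disp_t} {T : finPOrderType d}.
Implicit Types (x y z u v w : T) (F G : {set T}).

Lemma facet_order_complexP F :
  reflect ({in F &, forall u v, (u >=< v)%O} /\
           forall z, {in F, forall u, (z >=< u)%O} -> z \in F)
          (F \in facets (order_complex T)).
Proof.
have chainP G : reflect {in G &, forall u v, (u >=< v)%O} (G \in order_complex T).
  rewrite inE; apply: (iffP forall_inP) => h.
    by move=> u v uG vG; have /forall_inP-/(_ v vG) := h u uG.
  by move=> u uG; apply/forall_inP => v vG; exact: h.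
rewrite inE; apply: (iffP maxsetP) => [[/chainP chF maxF]|[chF maxF]].
  split=> // z zF; suff <- : z |: F = F by exact: setU11.
  apply: maxF (subsetUr _ _); apply/chainP => u v /setU1P[->|uF] /setU1P[->|vF].
  - exact: comparablexx.
  - exact: zF.
  - by rewrite comparable_sym; exact: zF.
  - exact: chF.
split=> [|G /chainP chG FG]; first exact/chainP.
apply/eqP; rewrite eqEsubset FG andbT; apply/subsetP => z zG.
by apply: maxF => u uF; apply: chG => //; exact: (subsetP FG).
Qed.

Lemma exists_facet F : {in F &, forall u v, (u >=< v)%O} ->
  exists2 G, G \in facets (order_complex T) & F \subset G.
Proof.
move=> chF; have FK : F \in order_complex T.
  by rewrite inE; apply/forall_inP => u uF; apply/forall_inP => v vF; exact: chF.
by have [G Gmax FG] := maxset_exists FK; exists G; rewrite // inE.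
Qed.

Lemma path_covered_le x p : path (@covered _ T) x p -> (x <= last x p)%O.
Proof.
elim: p x => //= y p IHp x /andP[/andP[xy _] /IHp]; exact: le_trans (ltW xy).
Qed.

Lemma coveredP x y :
  reflect ((x < y)%O /\ forall z, (x < z)%O -> ~ (z < y)%O) (covered x y).
Proof.
apply: (iffP andP) => -[xy h]; split=> //.
  by move=> z xz zy; move/existsP: h; apply; exists z; rewrite xz zy.
by apply/existsP => -[z /andP[xz]]; exact: h.
Qed.

(** The interval from [u] to [w] has a single saturated chain, so the increasing chain demanded by
    the labelling must be that one. *)
Lemma EL_rank2_le {d' : Order.disp_t} (L : porderType d') (lam : T -> T -> L) u v w :
  EL_labeling lam -> covered u v -> covered v w ->
  (forall z, (u < z)%O -> (z < w)%O -> z = v) -> (lam u v <= lam v w)%O.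
Proof.
move=> EL /coveredP[uv cuv] /coveredP[vw cvw] only.
have uw := lt_trans uv vw.
have [[|z1 q] [[[/= cq lq] srt] _ _]] := EL u w (ltW uw).
  by rewrite lq ltxx in uw.
have /andP[/coveredP[uz1 cz1] {}cq] := cq.
have : (z1 <= w)%O by rewrite -lq path_covered_le.
rewrite [(z1 <= w)%O]le_eqVlt => /predU1P[z1w|z1w].
  by case: (cz1 v) => //; rewrite z1w.
move: (only _ uz1 z1w) cq lq srt => {cz1 z1w uz1}-> {z1}.
case: q => [|z2 q] /=; first by move=> _ vE; rewrite vE ltxx in vw.
move=> /andP[/coveredP[vz2 _]] /path_covered_le le2 lq /andP[+ _].
suff -> : z2 = w by [].
by move: le2; rewrite lq le_eqVlt => /predU1P[|/(cvw _ vz2)].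
Qed.

(** An interval of length three whose open part is disconnected. Each side has two inner elements,
    so that rerouting a maximal chain replaces two vertices at once; a diamond would be no
    obstruction. *)
Definition hexagon x a b a' b' y : Prop :=
  [/\ [&& x < a, a < b & b < y]%O, [&& x < a', a' < b' & b' < y]%O,
      forall z, (x < z)%O -> (z < y)%O -> z \in [:: a; b; a'; b']
    & {in [:: a; b] & [:: a'; b'], forall u v, ~~ (u >=< v)%O}].

Lemma hexagon_sym x a b a' b' y : hexagon x a b a' b' y -> hexagon x a' b' a b y.
Proof.
case=> h h' int inc; split=> // [z xz zy|u v uin vin].
  by have := int z xz zy; rewrite !inE => /or4P[]->; rewrite ?orbT.
by rewrite comparable_sym; exact: inc.
Qed.

(** The intervals from [x] to [b] and from [a] to [y] contain nothing of the other side, so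
    [EL_rank2_le] applies to both and the labels of the whole side increase. *)
Lemma hexagon_EL_labels x a b a' b' y {d' : Order.disp_t} (L : porderType d')
    (lam : T -> T -> L) :
  hexagon x a b a' b' y -> EL_labeling lam ->
  saturated_chain x y [:: a; b; y] /\ (lam x a <= lam a b <= lam b y)%O.
Proof.
case=> /and3P[xa ab by_] /and3P[xa' ab' by'] int inc EL.
have only z : (x < z)%O -> (z < y)%O -> (z >=< a)%O || (z >=< b)%O ->
    z = a \/ z = b.
  move=> xz zy cmp; have := int z xz zy.
  rewrite !inE => /or4P[]/eqP zE; [by left|by right|exfalso|exfalso].
    by move: cmp; rewrite zE ![(a' >=< _)%O]comparable_sym;
       rewrite !(negbTE (inc _ _ _ _)) ?inE ?eqxx ?orbT.
  by move: cmp; rewrite zE ![(b' >=< _)%O]comparable_sym;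
     rewrite !(negbTE (inc _ _ _ _)) ?inE ?eqxx ?orbT.
have cxa : covered x a.
  apply/coveredP; split=> // z xz za.
  have zy : (z < y)%O by apply: lt_trans za (lt_trans ab by_).
  have [|zE|zE] := only z xz zy; first by rewrite (lt_comparable za).
    by rewrite zE ltxx in za.
  by have := lt_trans za ab; rewrite zE ltxx.
have cab : covered a b.
  apply/coveredP; split=> // z az zb.
  have [|||zE|zE] := only z; rewrite ?(lt_trans xa az) ?(lt_trans zb by_) //.
  - by rewrite (lt_comparable zb) orbT.
  - by rewrite zE ltxx in az.
  - by rewrite zE ltxx in zb.
have cby : covered b y.
  apply/coveredP; split=> // z bz zy.
  have [|||zE|zE] := only z; rewrite ?(lt_trans xa (lt_trans ab bz)) //.
  - by rewrite [(z >=< b)%O]comparable_sym (lt_comparable bz) orbT.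
  - by have := lt_trans ab bz; rewrite zE ltxx.
  - by rewrite zE ltxx in bz.
split; first by split; rewrite //= cxa cab cby.
apply/andP; split; apply: EL_rank2_le => // z lz zl.
  have [|||//|zE] := only z; rewrite ?lz ?(lt_trans zl by_) //.
    by rewrite (lt_comparable zl) orbT.
  by rewrite zE ltxx in zl.
have [|||zE|//] := only z; rewrite ?(lt_trans xa lz) //.
  by rewrite [(z >=< a)%O]comparable_sym (lt_comparable lz).
by rewrite zE ltxx in lz.
Qed.

Lemma hexagon_not_EL x a b a' b' y :
  hexagon x a b a' b' y -> ~ EL_shellable T.
Proof.
move=> hex [_ [d' [L [lam EL]]]].
have [sat /andP[l1 l2]] := hexagon_EL_labels hex EL.
have [sat' /andP[l1' l2']] := hexagon_EL_labels (hexagon_sym hex) EL.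
have [/and3P[xa ab by_] _ _ inc] := hex.
have [p [_ uniqp _]] := EL x y (ltW (lt_trans xa (lt_trans ab by_))).
have [] : [:: a; b; y] = [:: a'; b'; y].
  have -> : [:: a; b; y] = p by apply: uniqp sat _; rewrite /= l1 l2.
  by symmetry; apply: uniqp sat' _; rewrite /= l1' l2'.
by move=> aE _; have := inc a a'; rewrite !inE !eqxx aE comparablexx => /(_ _ _)/negP[].
Qed.

(** Extend one side to a maximal chain [F] and let [G] be its reroute along the other side. The
    common part is completed to a maximal chain only by one of the two sides, and each side adds two
    vertices. *)
Lemma hexagon_not_shellable x a b a' b' y :
  hexagon x a b a' b' y -> ~ shellable T.
Proof.
case=> /and3P[xa ab by_] /and3P[xa' ab' by'] int inc.
have xb := lt_trans xa ab; have ay := lt_trans ab by_.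
have xy := lt_trans xa ay; have xb' := lt_trans xa' ab'; have ay' := lt_trans ab' by'.
(* Such a [z] is not strictly inside the interval, so it is below [x] or above [y]. *)
have outside z : (z >=< x)%O -> (z >=< y)%O -> z \notin [:: a; b; a'; b'] ->
    {in [:: a; b; a'; b'], forall u, (z >=< u)%O}.
  move=> zx zy zn u uin.
  have [xu uy] : (x < u)%O /\ (u < y)%O.
    by move: uin; rewrite !inE => /or4P[]/eqP->.
  have [zx'|xz] : (z <= x)%O \/ (x < z)%O by case: (comparable_leP zx); [left|right].
    by rewrite (lt_comparable (le_lt_trans zx' xu)).
  have [zy'|yz] : (y <= z)%O \/ (z < y)%O by case: (comparable_ltP zy); [right|left].
    by rewrite comparable_sym (lt_comparable (lt_le_trans uy zy')).
  by rewrite int in zn.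
have [|F FK subF] := @exists_facet [set x; a; b; y].
  move=> u v; rewrite !inE -!orbA.
  move=> /or4P[]/eqP-> /or4P[]/eqP->; rewrite ?comparablexx //;
  by [apply: lt_comparable | rewrite comparable_sym; apply: lt_comparable].
have [chF maxF] := facet_order_complexP F FK.
have [xF aF bF yF] : [/\ x \in F, a \in F, b \in F & y \in F].
  by split; apply: (subsetP subF); rewrite !inE eqxx ?orbT.
have [a'F b'F] : a' \notin F /\ b' \notin F.
  by split; apply/negP => /(chF _ _ aF); apply/negP/inc; rewrite !inE eqxx ?orbT.
pose G := (F :\: [set a; b]) :|: [set a'; b'].
have FnG z : z \in F -> z \notin [:: a; b] -> z \notin [:: a; b; a'; b'].
  move=> zF; rewrite !inE !negb_or => /andP[-> ->] /=.
  by rewrite (contraNneq _ a'F) ?(contraNneq _ b'F) // => <-.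
have a'b' u v : u \in [:: a'; b'] -> v \in [:: a'; b'] -> (u >=< v)%O.
  rewrite !inE => /orP[]/eqP-> /orP[]/eqP->; rewrite ?comparablexx //.
    exact: lt_comparable.
  by rewrite comparable_sym lt_comparable.
have ab_ne u v : u \in [:: a; b] -> v \in [:: a'; b'] -> u != v.
  by move=> ui vi; apply: contraNneq (inc _ _ ui vi) => ->; exact: comparablexx.
have inG z : z \in G -> [\/ z \in [:: a'; b'] | z \in F /\ z \notin [:: a; b]].
  by rewrite !inE => /orP[/andP[]|]; [right|left].
have xG : x \in G.
  by rewrite !inE xF andbT (lt_eqF xa) (lt_eqF xb).
have yG : y \in G.
  by rewrite !inE yF andbT (gt_eqF ay) (gt_eqF by_).
have subG z : z \in [:: a'; b'] -> z \in G by rewrite !inE => ->; rewrite orbT.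
(* Both [x] and [y] survive the removal of [a] and [b], so [outside] supplies comparability with the
   two missing elements. *)
have maxG z : {in F :\: [set a; b], forall u, (z >=< u)%O} ->
    z \notin [:: a; b; a'; b'] -> z \in F.
  move=> zc zn; apply: maxF => u uF.
  have [uab|uab] := boolP (u \in [:: a; b]).
    apply: outside => //; try by apply: zc; rewrite !inE ?(lt_eqF xa) ?(lt_eqF xb)
      ?(gt_eqF ay) ?(gt_eqF by_).
    by move: uab; rewrite !inE => /orP[]->; rewrite ?orbT.
  by apply: zc; move: uab; rewrite !inE uF andbT.
have GK : G \in facets (order_complex T).
  apply/facet_order_complexP; split=> [u v /inG hu /inG hv|z zG].
    case: hu hv => [ui|[uF un]] [vi|[vF vn]].
    - exact: a'b'.
    - rewrite comparable_sym; apply: outside; rewrite ?chF ?FnG //.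
      by move: ui; rewrite !inE => /orP[]->; rewrite ?orbT.
    - apply: outside; rewrite ?chF ?FnG //.
      by move: vi; rewrite !inE => /orP[]->; rewrite ?orbT.
    - exact: chF.
  have [|zn] := boolP (z \in [:: a; b; a'; b']).
    rewrite (_ : [:: a; b; a'; b'] = [:: a; b] ++ [:: a'; b']) // mem_cat.
    case/orP=> [zab|]; last exact: subG.
    by case/negP: (inc z a' zab (mem_head _ _)); exact/zG/subG/mem_head.
  rewrite 2!inE (maxG _ _ zn); first by move: zn; rewrite !inE !negb_or; case/and4P=> -> ->.
  by move=> u uF; apply: zG; rewrite inE uF.
have FGE : F :&: G = F :\: [set a; b].
  apply/setP => z; rewrite !inE; case: (boolP (z \in F)) => zF /=; last by rewrite andbF.
  rewrite andbT; have [zE|] := eqVneq z a'; first by rewrite -zE zF in a'F.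
  have [zE|] := eqVneq z b'; first by rewrite -zE zF in b'F.
  by rewrite ?orbF ?andbT.
apply: (not_shellable_two_facets FK GK) => [H HK||]; last first.
- rewrite (leq_trans _ (subset_leq_card (_ : [set a'; b'] \subset _))) //.
    by rewrite cards2 (lt_eqF ab').
  by apply/subsetP => z; rewrite !inE => /orP[]/eqP->; rewrite ?a'F ?b'F ?eqxx ?orbT.
- rewrite (leq_trans _ (subset_leq_card (_ : [set a; b] \subset _))) //.
    by rewrite cards2 (lt_eqF ab).
  apply/subsetP => z; rewrite !inE => /orP[]/eqP->; rewrite ?aF ?bF ?eqxx ?orbT /= andbT.
    by rewrite negb_or !ab_ne // !inE eqxx ?orbT.
  by rewrite negb_or !ab_ne // !inE eqxx ?orbT.
rewrite FGE => subH; have [chH maxH] := facet_order_complexP H HK.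
have HF z : z \in H -> z \notin [:: a; b; a'; b'] -> z \in F :\: [set a; b].
  move=> zH zn; rewrite !inE (maxG _ _ zn) ?andbT.
    by move: zn; rewrite !inE !negb_or; case/and4P=> -> ->.
  by move=> u uF; apply: chH => //; exact: (subsetP subH).
have facet_sub A B : A \in facets (order_complex T) -> B \in facets (order_complex T) ->
    A \subset B -> A = B.
  by rewrite !inE => /maxsetP[_ mA] /maxsetP[BK _] AB; rewrite (mA B).
have [[v vi vH]|nab] := pselect (exists2 v, v \in [:: a'; b'] & v \in H).
  right; apply: facet_sub => //; apply/subsetP => z zH.
  have [|zn] := boolP (z \in [:: a; b; a'; b']); last by rewrite inE HF.
  rewrite (_ : [:: a; b; a'; b'] = [:: a; b] ++ [:: a'; b']) // mem_cat.
  case/orP=> [zab|]; last exact: subG.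
  by have := inc z v zab vi; rewrite chH.
left; apply: facet_sub => //; apply/subsetP => z zH.
have [|zn] := boolP (z \in [:: a; b; a'; b']); last by have := HF z zH zn; rewrite inE => /andP[].
rewrite (_ : [:: a; b; a'; b'] = [:: a; b] ++ [:: a'; b']) // mem_cat.
case/orP=> [|zab]; first by rewrite !inE => /orP[]/eqP->.
by case: nab; exists z.
Qed.

End OrderComplex.
(** * Posets ordered by coordinates *)

Section Componentwise.
Context {d : Order.disp_t} {T : finPOrderType d} (N : nat) (phi : T -> nat -> nat).
Implicit Types (x y z t u v w : T) (F G H : {set T}) (i j k l : nat).

Hypothesis phi_le : forall x y,
  (x <= y)%O <-> (forall i, i < N -> phi x i <= phi y i).
(** Only the first coordinate in which [x] and [y] differ needs to be raisable. This fits decreasing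
    sequences: the earlier entries agree with those of [y] and so leave room for the raised one. *)
Hypothesis phi_raise : forall x y i, (x <= y)%O -> i < N ->
  (forall j, j < i -> phi x j = phi y j) -> phi x i < phi y i ->
  exists z, forall k, k < N -> phi z k = phi x k + (k == i).
Hypothesis phi_meet : forall x y, exists2 z, (z <= x)%O & (z <= y)%O.
Variable top : T.
Hypothesis le_top : forall x, (x <= top)%O.

Let rank x := \sum_(i < N) phi x i.
(** Raising coordinate [i] adds exactly [i], so a difference of weights along a cover recovers the
    raised coordinate. *)
Let weight x := \sum_(i < N) i * phi x i.
Let raise x i z := i < N /\ forall k, k < N -> phi z k = phi x k + (k == i).
Local Notation facet F := (F \in facets (order_complex T)).

Let phi_inj x y : (forall i, i < N -> phi x i = phi y i) -> x = y.
Proof. by move=> h; apply/eqP; rewrite eq_le; apply/andP; split; apply/phi_le => i /h->. Qed.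

Let sum_raise (c : nat -> nat) x i z : raise x i z ->
  \sum_(k < N) c k * phi z k = \sum_(k < N) c k * phi x k + c i.
Proof.
case=> ltN h; under eq_bigr => k _ do rewrite (h k (ltn_ord k)) mulnDr.
rewrite big_split /=; congr addn.
rewrite (bigD1 (Ordinal ltN)) //= eqxx muln1 big1 ?addn0 // => k /negbTE kne.
by rewrite -val_eqE /= in kne; rewrite kne muln0.
Qed.

Let weight_raise x i z : raise x i z -> weight z = weight x + i.
Proof. exact: (sum_raise (fun k => k)). Qed.

Let rank_raise x i z : raise x i z -> rank z = (rank x).+1.
Proof.
have e y : \sum_(k < N) 1 * phi y k = rank y.
  by apply: eq_bigr => k _; rewrite mul1n.
by move/(sum_raise (fun=> 1)); rewrite !e addn1.
Qed.

Let raise_uniq x i z z' : raise x i z -> raise x i z' -> z = z'.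
Proof. by case=> _ h [_ h']; apply: phi_inj => k ltk; rewrite h ?h'. Qed.

Let raise_lt x i z : raise x i z -> (x < z)%O.
Proof.
case=> ltN h; rewrite lt_neqAle; apply/andP; split.
  by apply/eqP => xz; have := h i ltN; rewrite xz eqxx; lia.
by apply/phi_le => k ltk; rewrite h // leq_addr.
Qed.

Let lt_first x y : (x < y)%O -> exists i,
  [/\ i < N, forall j, j < i -> phi x j = phi y j & phi x i < phi y i].
Proof.
move=> xy; have lexy := (phi_le x y).1 (ltW xy).
have ex : exists i, (i < N) && (phi x i < phi y i).
  apply/not_existsP => h; move: (xy); rewrite lt_neqAle => /andP[/eqP[]].
  apply: phi_inj => i ltN; apply/eqP; rewrite eqn_leq lexy // leqNgt.
  by apply/negP => lti; apply: (h i); rewrite ltN.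
exists (ex_minn ex); case: ex_minnP => i /andP[ltN lti] mini; split=> // j ltj.
apply/eqP; rewrite eqn_leq lexy ?(ltn_trans ltj) // leqNgt.
by apply/negP => h; have := mini j; rewrite h (ltn_trans ltj) // leqNgt ltj => /(_ isT).
Qed.

Let lt_raise x y : (x < y)%O -> exists i z,
  [/\ raise x i z, (z <= y)%O, forall j, j < i -> phi x j = phi y j
    & phi x i < phi y i].
Proof.
move=> xy; have [i [ltN eqi lti]] := lt_first xy.
have [z hz] := phi_raise (ltW xy) ltN eqi lti; exists i, z; split=> //.
apply/phi_le => k ltk; rewrite hz //; have := (phi_le x y).1 (ltW xy) k ltk.
by case: eqP => [->|]; lia.
Qed.

Let rank_lt x y : (x < y)%O -> rank x < rank y.
Proof.
move=> xy; have [i [z [rz zy _ _]]] := lt_raise xy.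
rewrite -(rank_raise rz); apply: leq_sum => k _.
exact: (phi_le z y).1 zy k (ltn_ord k).
Qed.

Let comparable_rank_inj x y : (x >=< y)%O -> rank x = rank y -> x = y.
Proof.
by move=> /comparable_ltgtP[/rank_lt|/rank_lt|//]; lia.
Qed.

(** Below any larger element there is a raise of [x], and a raise increases the rank by one only,
    which leaves no room in between. *)
Let covered_raise x y : covered x y <-> exists i, raise x i y.
Proof.
split=> [/coveredP[xy cov]|[i ri]].
  have [i [z [rz zy _ _]]] := lt_raise xy; exists i.
  have [<-//|ne] := eqVneq z y; case: (cov z (raise_lt rz)).
  by rewrite lt_neqAle ne.
apply/coveredP; split=> [|z /rank_lt h1 /rank_lt]; first exact: raise_lt ri.
by rewrite (rank_raise ri); lia.
Qed.

Let lam x y : nat := weight y - weight x.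

Let lam_raise x i y : raise x i y -> lam x y = i.
Proof. by move/weight_raise; rewrite /lam => ->; lia. Qed.

(** Coordinates never decrease along a chain, so the set of labels depends only on the two ends.
    This bounds the labels of all chains of an interval simultaneously. *)
Let mem_labels x p i : path (@covered _ T) x p -> i < N ->
  (i \in pairmap lam x p) = (phi x i < phi (last x p) i).
Proof.
elim: p x => [|y p IHp] x /=; first by rewrite ltnn.
case/andP=> /covered_raise[l rl] cp ltN; rewrite inE IHp // (lam_raise rl).
have := (phi_le y (last y p)).1 (path_covered_le cp) i ltN.
by rewrite (rl.2 i ltN); case: eqP => _ /=; lia.
Qed.

Let labels_lt x p i : path (@covered _ T) x p -> i \in pairmap lam x p -> i < N.
Proof.
elim: p x => //= y p IHp x /andP[/covered_raise[l rl] cp].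
by rewrite inE (lam_raise rl) => /predU1P[->|/(IHp _ cp)//]; case: rl.
Qed.

(* The increasing chain of an interval raises the coordinates one after the
   other, from the first to the last. *)
Let EL_lam : EL_labeling (L := nat) lam.
Proof.
move=> x y; move eqn: (rank y - rank x) => n.
elim: n => [|n IHn] in x eqn * => xy.
  have xE : x = y.
    by apply/eqP/negP => /negP ne; have := @rank_lt x y; rewrite lt_neqAle ne xy; lia.
  rewrite xE; exists [::]; split=> // q [cq lq]; case: q cq lq => //= z q.
  by move=> /andP[/coveredP[yz _] /path_covered_le le_z] lq;
     have := lt_le_trans yz le_z; rewrite lq ltxx.
have lt_xy : (x < y)%O.
  by rewrite lt_neqAle xy andbT; apply/eqP => xE; move: eqn; rewrite xE subnn.
have [i [z [rz zy eqi lti]]] := lt_raise lt_xy; have ltN := rz.1.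
have [||p [[satp srtp] uniqp minp]] := IHn z; rewrite ?(rank_raise rz) //.
  by have := rank_lt lt_xy; lia.
(* The ends agree on all coordinates before [i], so no chain carries a smaller label. *)
have lam_ge q : saturated_chain x y q -> forall l, l \in pairmap lam x q -> i <= l.
  move=> [cq lq] l lin; have := mem_labels cq (labels_lt cq lin).
  rewrite lin lq => /esym ltl; rewrite leqNgt; apply/negP => /eqi eql.
  by rewrite eql ltnn in ltl.
have cxz : covered x z by apply/covered_raise; exists i.
have satzp : saturated_chain x y (z :: p).
  by case: satp => cp lp; split; rewrite //= cxz.
have step w q : saturated_chain x y (w :: q) -> lam x w = i ->
    w = z /\ saturated_chain z y q.
  move=> [/= /andP[/covered_raise[l rl] cq] lq]; rewrite (lam_raise rl) => lE.
  have wz : w = z by apply: (raise_uniq rl); rewrite lE.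
  by rewrite -wz; split=> //; split.
have neq0 q : saturated_chain x y q -> q <> [::].
  by move=> [_ lq] qE; move: lt_xy; rewrite -lq qE ltxx.
exists (z :: p); split.
- split=> //=; rewrite (lam_raise rz) path_min_sorted //.
  apply/allP => l lin; rewrite leEnat; apply: (lam_ge _ satzp).
  by rewrite /= inE lin orbT.
- case=> [/neq0//|w q] satq /= srtq.
  (* Label [i] occurs on every chain of the interval, and an increasing chain starts with its
     smallest label. *)
  have wi : lam x w = i.
    apply/eqP; rewrite eqn_leq (lam_ge _ satq) /= ?mem_head // andbT.
    have [cq lq] := satq; have := mem_labels cq ltN.
    rewrite lq lti /= inE => /predU1P[->//|iin].
    by have := order_path_min le_trans srtq => /allP/(_ i iin); rewrite leEnat.
  have [wz satq'] := step _ _ satq wi; rewrite wz in srtq *.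
  by rewrite (uniqp q) //; exact: path_sorted srtq.
case=> [/neq0//|w q] satq neq /=.
rewrite /= ltxi_cons (lam_raise rz) leEnat (lam_ge _ satq) /= ?mem_head //.
apply/implyP => lew; have wi : lam x w = i.
  by apply/eqP; rewrite eqn_leq lew (lam_ge _ satq) //= mem_head.
have [wz satq'] := step _ _ satq wi.
by rewrite wz; apply: minp => // qp; apply: neq; rewrite wz qp.
Qed.

(** An element of least rank has no proper lower bound, so a common lower bound with [x] must be
    that element itself. *)
Let bot_exists : exists b : T, forall x, (b <= x)%O.
Proof.
have [b _ minb] := @arg_minnP _ top xpredT rank isT; exists b => x.
have [z zb zx] := phi_meet b x.
have [<-//|ne] := eqVneq z b.
have : rank z < rank b by apply: rank_lt; rewrite lt_neqAle ne.
by rewrite ltnNge minb.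
Qed.

Lemma componentwise_EL_shellable : EL_shellable T.
Proof.
have [b le_b] := bot_exists; split; last by exists _, nat, lam.
split; [exists b | exists top]; split.
- by move=> y yb; apply/eqP; rewrite eq_le yb le_b.
- by move=> y miny; apply: miny.
- by move=> y ty; apply/eqP; rewrite eq_le ty le_top.
- by move=> y maxy; apply: maxy.
Qed.

Let facet_top F : facet F -> top \in F.
Proof.
move=> /facet_order_complexP[_]; apply=> u _.
by rewrite comparable_sym le_comparable.
Qed.

(** Let [z] be the element of least rank in [F] above [x]. Some raise of [x] lies weakly below [z];
    it is comparable to all of [F], so it belongs to [F] by maximality and equals [z]. *)
Let facet_next F x : facet F -> x \in F -> x != top ->
  exists i z, [/\ z \in F, raise x i z & forall w, w \in F -> (x < w)%O -> (z <= w)%O].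
Proof.
move=> fF xF xt; have [chF maxF] := facet_order_complexP F fF.
have [|z /andP[zF xz] minz] := @arg_minnP _ top (fun z => (z \in F) && (x < z)%O) rank.
  by rewrite facet_top // lt_neqAle xt le_top.
have lez w : w \in F -> (x < w)%O -> (z <= w)%O.
  move=> wF xw; have /comparable_leP[//|wz] := chF _ _ zF wF.
  by have := minz w; rewrite wF xw leqNgt rank_lt // => /(_ isT).
have [i [z0 [rz0 z0z _ _]]] := lt_raise xz; exists i, z; split=> //.
suff <- : z0 = z by [].
apply/eqP; rewrite eq_le z0z lez ?(raise_lt rz0) //.
apply: maxF => w wF; have /comparable_leP[wx|xw] := chF _ _ wF xF.
  by rewrite comparable_sym le_comparable // (le_trans wx) // ltW // (raise_lt rz0).
by rewrite le_comparable // (le_trans z0z) // lez.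
Qed.

(** Raises are only available upwards, so the predecessor is found as the highest element of [F]
    below [z], whose successor is then forced to be [z]. *)
Let facet_prev F x z : facet F -> x \in F -> z \in F -> (x < z)%O ->
  exists i y, [/\ y \in F, raise y i z & (x <= y)%O].
Proof.
move=> fF xF zF xz; have [chF maxF] := facet_order_complexP F fF.
have [|y /andP[yF yz] maxy] :=
  @arg_maxnP _ x (fun y => (y \in F) && (y < z)%O) rank; first by rewrite xF xz.
have [|i [w [wF rw lew]]] := @facet_next F y fF yF.
  by apply/eqP => yt; have := lt_le_trans yz (le_top z); rewrite yt ltxx.
exists i, y; split=> //.
  suff <- : w = z by [].
  have := lew z zF yz; rewrite le_eqVlt => /predU1P[//|wz].
  have : rank w <= rank y by apply: maxy; rewrite wF.
  by rewrite leqNgt (rank_lt (raise_lt rw)).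
have /comparable_leP[//|yx] := chF _ _ xF yF.
have : rank x <= rank y by apply: maxy; rewrite xF.
by rewrite leqNgt rank_lt.
Qed.

(** The chain enters [v] with label [j] and leaves it with the smaller label [i]. *)
Let descent F v := exists u w i j,
  [/\ u \in F, w \in F, i < j, raise u j v & raise v i w].

Let W F := \sum_(z in F) weight z.

(** The two raises around [v] are performed in the opposite order. The new middle element [v'] has
    the rank of [v], hence is not in [F], and weighs less because [i < j]. *)
Let swap_descent F v : facet F -> v \in F -> descent F v ->
  exists v', [/\ facet (v' |: F :\ v), W (v' |: F :\ v) < W F & v' \notin F].
Proof.
move=> fF vF [u [w [i [j [uF wF ltij ru rw]]]]].
have [chF maxF] := facet_order_complexP F fF.
have ltuv := raise_lt ru; have ltvw := raise_lt rw.
have ltN := rw.1; have ltuw := lt_trans ltuv ltvw.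
have phiw k : k < N -> phi w k = phi u k + (k == j) + (k == i).
  by move=> ltk; rewrite rw.2 // ru.2.
(* Since [i < j], coordinate [i] is the first in which [u] and [w] differ. *)
have [||v' hv'] := @phi_raise u w i (ltW ltuw) ltN.
- by move=> k ltk; have := phiw k (ltn_trans ltk ltN); lia.
- by rewrite phiw // eqxx addn1 ltnS leq_addr.
have rv' : raise u i v' by [].
have v'w : (v' <= w)%O by apply/phi_le => k ltk; rewrite hv' // phiw //; lia.
have wv : weight v' < weight v by rewrite (weight_raise rv') (weight_raise ru) ltn_add2l.
have rvv' : rank v = rank v' by rewrite (rank_raise rv') (rank_raise ru).
have vNv' : ~~ (v >=< v')%O.
  by apply/negP => /comparable_rank_inj-/(_ rvv') vE; rewrite vE ltnn in wv.
have v'F : v' \notin F by apply: contra vNv' => /(chF v v' vF).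
(* The ranks of [u] and [w] differ by two, so an element strictly between them has the middle
   rank. *)
have between t : (t >=< u)%O -> (t >=< w)%O ->
    [\/ (t <= u)%O, (w <= t)%O | rank t = rank v].
  move=> /comparable_leP[|ut]; first by constructor 1.
  move=> /comparable_ltP[tw|]; last by constructor 2.
  constructor 3; have := rank_lt ut; have := rank_lt tw.
  rewrite (rank_raise rw) (rank_raise ru) ltnS => h1 h2.
  by apply/eqP; rewrite eqn_leq h1 h2.
have out t x : (u <= x)%O -> (x <= w)%O -> (t <= u)%O \/ (w <= t)%O -> (t >=< x)%O.
  move=> ux xw [tu|wt]; first by rewrite le_comparable // (le_trans tu).
  by rewrite comparable_sym le_comparable // (le_trans xw).
have ltuv' := raise_lt rv'.
exists v'; split=> //; last first.
  rewrite /W big_setU1 /=; last by rewrite !inE (negbTE v'F) andbF.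
  by rewrite [in ltnRHS](big_setD1 v) //= ltn_add2r.
have Fv t : t \in F :\ v -> (t <= u)%O \/ (w <= t)%O.
  rewrite !inE => /andP[tv tF].
  have [||tu|wt|rt] := between t; rewrite ?chF //; try by [left|right].
  by case/eqP: tv; apply: comparable_rank_inj => //; exact: chF.
have inH t : t \in F -> t != v -> t \in v' |: F :\ v by rewrite !inE => -> ->; rewrite orbT.
apply/facet_order_complexP; split=> [s t|t tH].
  move=> /setU1P[->|sF] /setU1P[->|tF]; rewrite ?comparablexx //.
  - by rewrite comparable_sym out ?(ltW ltuv') //; exact: Fv.
  - by rewrite out ?(ltW ltuv') //; exact: Fv.
  - by apply: chF; [move: sF | move: tF]; rewrite inE => /andP[].
have tu : (t >=< u)%O by apply/tH/inH; rewrite // (lt_eqF ltuv).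
have tw : (t >=< w)%O by apply/tH/inH; rewrite // (gt_eqF ltvw).
have [h|rt] : ((t <= u)%O \/ (w <= t)%O) \/ rank t = rank v.
- by case: (between t tu tw) => h; [left; left|left; right|right].
- have tv : (t >=< v)%O by apply: out => //; exact: ltW.
  apply: (inH t).
    by apply: maxF => s sF; have [->//|sv] := eqVneq s v; apply/tH/inH.
  apply/eqP => tE; case: h; rewrite tE => h.
    by have := lt_le_trans ltuv h; rewrite ltxx.
  by have := lt_le_trans ltvw h; rewrite ltxx.
- have -> : t = v' by apply: comparable_rank_inj; rewrite ?rt // tH // setU11.
  exact: setU11.
Qed.

(** After leaving [x] with the larger label [j], the chain [G] must still raise coordinate [i < j],
    which forces a descent. It occurs outside [F], because the elements of [F] above [x] already
    have coordinate [i] raised. *)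
Let diverge F G x i j z w : facet F -> facet G ->
  x \in F -> z \in F -> raise x i z -> x \in G -> w \in G -> raise x j w ->
  i < j -> (forall v, v \in G -> v \notin F -> ~ descent G v) -> False.
Proof.
move=> fF fG xF zF rz xG wG rw ltij nodesc.
have [chF _] := facet_order_complexP F fF.
have [chG _] := facet_order_complexP G fG.
(* The descent is at the last [t] in [G] that agrees with [x] before coordinate [j]: the step into
   [t] has label at least [j], the step out of it a label below [j]. *)
pose Q t := [&& t \in G, (x <= t)%O & [forall l : 'I_N, (l < j) ==> (phi t l == phi x l)]].
have Qw : Q w.
  rewrite /Q wG ltW ?(raise_lt rw) //=; apply/forallP => l; apply/implyP => ltl.
  by rewrite rw.2 // (ltn_eqF ltl) /= addn0.
have [t /and3P[tG xt /forallP tx] maxt] := @arg_maxnP _ w Q rank Qw.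
have {}tx l : l < j -> phi t l = phi x l.
  by move=> ltl; have /implyP := tx (Ordinal (ltn_trans ltl rw.1)) => /(_ ltl)/eqP.
have lt_xt : (x < t)%O.
  rewrite lt_neqAle xt andbT; apply/eqP => xE.
  have : rank w <= rank t by exact: maxt.
  by rewrite -xE leqNgt (rank_lt (raise_lt rw)).
have zNt : ~ (z <= t)%O.
  by move=> /phi_le/(_ i rz.1); rewrite rz.2 ?rz.1 // eqxx tx // addn1 ltnn.
have [|l [t2 [t2G rt2 _]]] := @facet_next G t fG tG.
  by apply/eqP => tE; apply: zNt; rewrite tE.
have [l' [t0 [t0G rt0 xt0]]] := facet_prev fG xG tG lt_xt.
have lel' : j <= l'.
  rewrite leqNgt; apply/negP => ltl; have := (phi_le x t0).1 xt0 l' rt0.1.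
  by rewrite -(tx _ ltl) rt0.2 ?rt0.1 // eqxx addn1 ltnn.
have ltl : l < j.
  rewrite ltnNge; apply/negP => lel.
  suff : rank t2 <= rank t by rewrite leqNgt (rank_lt (raise_lt rt2)).
  apply: maxt.
  rewrite /Q t2G (le_trans xt) ?ltW ?(raise_lt rt2) //=.
  apply/forallP => k; apply/implyP => ltk; rewrite rt2.2 // tx //.
  by rewrite (ltn_eqF (leq_trans ltk lel)) /= addn0.
have [tF|tF] := boolP (t \in F); last first.
  by apply: (nodesc t) => //; exists t0, t2, l, l'; split=> //; exact: leq_trans lel'.
have /comparable_leP[//|tz] := chF _ _ zF tF.
have := rank_lt tz; rewrite (rank_raise rz) ltnS => h.
by have := leq_ltn_trans h (rank_lt lt_xt); rewrite ltnn.
Qed.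

Let facet_sub_eq F G : facet F -> facet G -> F \subset G -> F = G.
Proof. by rewrite !inE => /maxsetP[_ mF] /maxsetP[GK _] FG; rewrite (mF G). Qed.

(** At the lowest element of [F] outside [G], the two chains leave a common element with different
    labels. Whichever chain takes the larger label has a descent outside the other by [diverge]. *)
Let no_descents_eq F G : facet F -> facet G ->
  (forall v, v \in G -> v \notin F -> ~ descent G v) ->
  (forall v, v \in F -> v \notin G -> ~ descent F v) -> F = G.
Proof.
move=> fF fG ndG ndF; apply: facet_sub_eq => //; apply/subsetP => z0 z0F.
apply/negP => /negP z0G.
have [|z /andP[zF zG] minz] :=
  @arg_minnP _ z0 (fun z => (z \in F) && (z \notin G)) rank; first by rewrite z0F.
have [b le_b] := bot_exists.
have botF H : facet H -> b \in H.
  by move=> /facet_order_complexP[_]; apply=> u _; rewrite le_comparable.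
have bz : (b < z)%O.
  by rewrite lt_neqAle le_b andbT; apply: contraNneq zG => <-; exact: botF.
have [i [y [yF ry _]]] := facet_prev fF (botF _ fF) zF bz.
have yG : y \in G.
  apply: contraT => yG; have := minz y; rewrite yF yG leqNgt.
  by rewrite (rank_lt (raise_lt ry)) => /(_ isT).
have [|j [w [wG rw _]]] := @facet_next G y fG yG.
  apply/eqP => yt; have := lt_le_trans (raise_lt ry) (le_top z).
  by rewrite yt ltxx.
case: (ltngtP i j) => [ltij|ltji|eqij].
- exact: (@diverge F G y i j z w).
- exact: (@diverge G F y j i w z).
- by rewrite eqij in ry; rewrite (raise_uniq ry rw) wG in zG.
Qed.

(** Descents of [F] outside [G] are swapped out one at a time. Only elements outside [G] are
    removed, so the hypothesis persists; each swap lowers [W], and by [no_descents_eq] the process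
    can stop only at [G]. *)
Let no_descent_min F G : facet F -> facet G -> F <> G ->
  (forall v, v \in G -> v \notin F -> ~ descent G v) -> W G < W F.
Proof.
elim/ltn_ind: (W F) {-2}F (erefl (W F)) => n IHn {}F FW fF fG neq ndG.
have [[v [vF vG dv]]|ndF] :=
    pselect (exists v, [/\ v \in F, v \notin G & descent F v]); last first.
  case: neq; apply: no_descents_eq => // v vF vG dv.
  by apply: ndF; exists v.
have [v' [fF' ltW' v'F]] := swap_descent fF vF dv.
have [<-|neq'] := pselect (v' |: F :\ v = G); first by [].
apply: ltn_trans (ltW'); rewrite FW in ltW'.
apply: (IHn _ ltW' _ erefl) => // t tG tF'; apply: ndG => //.
apply: contra tF' => tF; rewrite !inE tF andbT.
by rewrite (contraNneq _ vG) ?orbT // => <-.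
Qed.

(* Facets are ordered by total weight, which swapping out a descent decreases. *)
Lemma componentwise_shellable : shellable T.
Proof.
apply: (shellable_of_weight (W := W)) => F G fF fG neq leW.
have [v [vG vF dv]] : exists v, [/\ v \in G, v \notin F & descent G v].
  apply/not_existsP => h.
  have := @no_descent_min F G fF fG neq; rewrite ltnNge leW => hf.
  by suff : false by []; apply: hf => v vG vF dv; apply: (h v).
have [v' [fG' ltW' v'G]] := swap_descent fG vG dv.
by exists (v' |: G :\ v), v; split=> //; exact: subsetUr.
Qed.

End Componentwise.

(** * Kohnert moves *)

Implicit Types (D E : cells) (r c : nat).

Definition rightmost E r c := (r, c) \in E /\ forall c', c < c' -> (r, c') \notin E.

Definition highest_free E r c r' :=
  [/\ 0 < r' < r, (r', c) \notin E & forall j, r' < j < r -> (j, c) \in E].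

Lemma max_column_rightmost E r c : rightmost E r c ->
  \max_(x <- row_of E r) x.2 = c.
Proof.
case=> rcE right_c; have inrow : (r, c) \in row_of E r by rewrite !inE rcE /=.
apply/eqP; rewrite eqn_leq; apply/andP; split; last exact: (leq_bigmax_seq (F := snd) (r, c)).
apply/bigmax_leqP_seq => -[r0 c0] /=; rewrite !inE => /andP[xE /eqP/= r0E] _.
by rewrite leqNgt; apply: contraTN xE; rewrite r0E; exact: right_c.
Qed.

Lemma row_of_neq0 E r c : (r, c) \in E -> row_of E r != fset0.
Proof. by move=> rcE; apply/fset0Pn; exists (r, c); rewrite !inE rcE /=. Qed.

Lemma exists_rightmost E r c : (r, c) \in E ->
  exists2 c', c <= c' & rightmost E r c'.
Proof.
move=> rcE; have ub c' : (r, c') \in E -> c' <= \max_(x <- E) x.2.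
  by move=> cE; apply: (leq_bigmax_seq (F := snd) (r, c')).
have ex : exists c', (r, c') \in E by exists c.
case: (ex_maxnP ex ub) => m mE maxm.
exists m; first exact: maxm.
split=> // c' ltc; apply: contraTN ltc => /maxm; by rewrite leqNgt.
Qed.

(** Rows start at 1, so the value 0 of an empty maximum unambiguously means that no position is
    free. *)
Lemma max_free_spec (P : pred nat) r (m := \max_(1 <= i < r | P i) i) :
  (forall i, 0 < i < r -> P i -> i <= m) /\ (m != 0 -> 0 < m < r /\ P m).
Proof.
split=> [i ir Pi|].
  by apply: (leq_bigmax_seq (F := id) i); rewrite // mem_index_iota.
rewrite /m big_nat_cond; elim/big_ind: _ => [//|p q IHp IHq|i /andP[ir Pi] _ //].
by rewrite /maxn; case: ifP => _; [exact: IHq|exact: IHp].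
Qed.

Lemma kohnert_moveE E r c r' : rightmost E r c -> highest_free E r c r' ->
  kohnert_move E r = (r', c) |` (E `\ (r, c)).
Proof.
move=> rc [r'r r'E fill]; rewrite /kohnert_move (negbTE (row_of_neq0 rc.1)).
rewrite (max_column_rightmost rc) /=.
have [ub att] := max_free_spec (fun i => (i, c) \notin E) r.
set m := \max_(1 <= i < r | _) i in ub att *; have le_m := ub r' r'r r'E.
have m0 : m != 0 by lia.
have [mr mE] := att m0; rewrite (negbTE m0).
have [->//|ne] := eqVneq m r'.
by rewrite fill // in mE; lia.
Qed.

Lemma kohnert_moveP E r : kohnert_move E r = E \/
  exists c r', [/\ rightmost E r c, highest_free E r c r'
                 & kohnert_move E r = (r', c) |` (E `\ (r, c))].
Proof.
have [row0|/fset0Pn[[r0 c0]]] := eqVneq (row_of E r) fset0.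
  by left; rewrite /kohnert_move row0 eqxx.
rewrite !inE => /andP[xE /= /eqP r0E]; rewrite r0E in xE.
have [c _ rc] := exists_rightmost xE.
have [ub att] := max_free_spec (fun i => (i, c) \notin E) r.
have [m0|m0] := eqVneq (\max_(1 <= i < r | (i, c) \notin E) i) 0.
  left; rewrite /kohnert_move (negbTE (row_of_neq0 rc.1)).
  by rewrite (max_column_rightmost rc) /= m0.
right; exists c, (\max_(1 <= i < r | (i, c) \notin E) i).
have [mr mE] := att m0.
have hf : highest_free E r c (\max_(1 <= i < r | (i, c) \notin E) i).
  split=> // j jr; apply: contraT => jE.
  by have : j <= \max_(1 <= i < r | (i, c) \notin E) i; [apply: ub | ]; lia.
by split=> //; exact: kohnert_moveE.
Qed.

Lemma kohnert_move_KD E r : kohnert_move E r \in KD E.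
Proof. by apply/KDP; exists [:: r]. Qed.

Lemma move_cell_KD E r c r' : rightmost E r c -> highest_free E r c r' ->
  (r', c) |` (E `\ (r, c)) \in KD E.
Proof. by move=> rc hf; rewrite -(kohnert_moveE rc hf) kohnert_move_KD. Qed.

Lemma KD_ind (P : cells -> Prop) D : P D ->
  (forall E r, P E -> P (kohnert_move E r)) -> forall E, E \in KD D -> P E.
Proof.
move=> PD Pmove E /KDP[rs ->]; elim/last_ind: rs => [//|rs r IHrs].
by rewrite foldl_rcons; exact: Pmove.
Qed.

Lemma mem_move_cell E r c r' p : (p \in (r', c) |` (E `\ (r, c))) =
  (p == (r', c)) || ((p != (r, c)) && (p \in E)).
Proof. by rewrite !inE. Qed.

(** The cell descends one row per move. Row [t] may contain cells further right, since the cell is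
    never moved out of that row. *)
Lemma drop_cell_KD E s t c : (s, c) \in E -> 0 < t <= s ->
  (forall j, t <= j < s -> (j, c) \notin E) ->
  (forall c' j, c < c' -> t < j <= s -> (j, c') \notin E) ->
  (t, c) |` (E `\ (s, c)) \in KD E.
Proof.
move=> + /andP[t0]; elim: s E => [|s IHs] E; first lia.
move=> sE; rewrite leq_eqVlt => /predU1P[-> _ _|ts free right_free].
  by rewrite fsetD1K // KD_refl.
have sNE : (s, c) \notin E by apply: free; lia.
have step : (s, c) |` (E `\ (s.+1, c)) \in KD E.
  apply: move_cell_KD; first by split=> // c' lt_c; apply: right_free => //; lia.
  by split=> //; lia.
apply: KD_trans step _.
have -> : (t, c) |` (E `\ (s.+1, c)) =
    (t, c) |` (((s, c) |` (E `\ (s.+1, c))) `\ (s, c)).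
  apply/fsetP => p; rewrite !inE; case: (eqVneq p (s, c)) => [->|//] /=.
  by rewrite (negbTE sNE) andbF.
apply: IHs => //.
- by rewrite !inE eqxx.
- move=> j jr; rewrite !inE !xpair_eqE !eqxx !andbT (negbTE (free j _)) ?andbF; lia.
- move=> c' j lt_c jr; rewrite !inE !xpair_eqE (gtn_eqF lt_c) !andbF /=.
  by apply: right_free => //; lia.
Qed.

(** The cells of row [s] are moved from right to left, so each is rightmost when its turn comes. A
    move changes its own column only, hence the description column by column. *)
Lemma clear_row_KD E s k :
  (forall c, k <= c -> (s, c) \in E -> exists2 i, 0 < i < s & (i, c) \notin E) ->
  exists2 E', E' \in KD E &
    forall c, if (k <= c) && ((s, c) \in E) then
      exists2 r', highest_free E s c r' &
        forall i, ((i, c) \in E') = (i == r') || (i != s) && ((i, c) \in E)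
    else forall i, ((i, c) \in E') = ((i, c) \in E).
Proof.
(* The induction is on a strict bound for the columns occupied in row [s]. *)
have ub : exists n, forall c, (s, c) \in E -> c < n.
  exists (\max_(x <- E) x.2).+1 => c cE; rewrite ltnS.
  exact: (leq_bigmax_seq (F := snd) (s, c)).
case: ub => n; elim: n => [|n IHn] in E * => ub free.
  exists E; first exact: KD_refl.
  by move=> c; case: ifP => // /andP[_ /ub].
have [snE|snE] := boolP ((s, n) \in E); last first.
  by apply: IHn => // c cE; have := ub c cE; rewrite ltnS leq_eqVlt => /predU1P[cn|//];
     rewrite -cn cE in snE.
have [kn|kn] := leqP k n; last first.
  exists E; first exact: KD_refl.
  by move=> c; case: ifP => // /andP[kc /ub]; lia.
have rmn : rightmost E s n.
  by split=> // c ltc; apply/negP => /ub; lia.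
have [r' hf] : exists r', highest_free E s n r'.
  have [ubf att] := max_free_spec (fun i => (i, n) \notin E) s.
  have [i ir iE] := free n kn snE; have le_i := ubf i ir iE.
  have [|mr mE] := att; first by lia.
  eexists; split; [exact: mr | exact: mE |].
  by move=> j jr; apply: contraT => jE; have := ubf j _ jE; lia.
have [r's r'E fill] := hf.
set E1 := (r', n) |` (E `\ (s, n)).
have E1n i : ((i, n) \in E1) = (i == r') || (i != s) && ((i, n) \in E).
  by rewrite !inE !xpair_eqE !eqxx !andbT.
have E1c c i : c != n -> ((i, c) \in E1) = ((i, c) \in E).
  by move=> cn; rewrite !inE !xpair_eqE (negbTE cn) !andbF.
have sE1 : (s, n) \notin E1 by rewrite E1n eqxx /= orbF; lia.
have [||E' E'E1 hE'] := IHn E1.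
- move=> c; have [->|cn] := eqVneq c n; first by rewrite (negbTE sE1).
  by rewrite E1c // => /ub; lia.
- move=> c kc; have [->|cn] := eqVneq c n; first by rewrite (negbTE sE1).
  by rewrite E1c // => /(free c kc)[i ir iE]; exists i; rewrite ?E1c.
exists E'; first by apply: KD_trans E'E1; exact: move_cell_KD.
move=> c; have := hE' c; have [->|cn] := eqVneq c n.
  rewrite (negbTE sE1) andbF kn snE /= => h; exists r' => // i.
  by rewrite h E1n.
rewrite E1c //; case: ifP => _ => [[q [qs qE qf] h]|h i]; last by rewrite h E1c.
exists q; last by move=> i; rewrite h E1c.
by split=> // [|j jr]; [rewrite -(E1c c) | rewrite -(E1c c) // qf].
Qed.

(** * Hexagons in Kohnert posets *)

(* The case analysis of lia on the many membership hypotheses is exponential. *)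
Ltac nat_lia :=
  repeat match goal with
  | H : is_true (in_mem _ _) |- _ => clear H
  | H : is_true (~~ in_mem _ _) |- _ => clear H
  | H : forall _, _ |- _ => clear H
  end; lia.

(** Moves lower cells within their columns, so these counts are monotone invariants; they exclude
    moves that would leave a given interval. *)
Definition count_above E c h : nat := \sum_(x <- E) ((x.2 == c) && (h <= x.1)).

Lemma count_above_fset1U E x c h : x \notin E ->
  count_above (x |` E) c h = (x.2 == c) && (h <= x.1) + count_above E c h.
Proof. by move=> xE; rewrite /count_above big_fsetU1. Qed.

Lemma count_above_move_cell E r c r' k h : (r, c) \in E -> (r', c) \notin E ->
  count_above ((r', c) |` (E `\ (r, c))) k h + ((c == k) && (h <= r)) =
  count_above E k h + ((c == k) && (h <= r')).
Proof.
move=> rE r'E; rewrite count_above_fset1U /=; last by rewrite !inE (negbTE r'E) andbF.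
by rewrite {2}/count_above (big_fsetD1 (r, c) rE) /= -/(count_above _ _ _); nat_lia.
Qed.

Lemma count_above_KD D E k h : E \in KD D -> count_above E k h <= count_above D k h.
Proof.
move: E; apply: KD_ind => // E r IH; apply: leq_trans IH.
have [->//|[c [r' [[rE _] [r'r r'E _] ->]]]] := kohnert_moveP E r.
have := count_above_move_cell k h rE r'E.
by case: (c == k) => /=; nat_lia.
Qed.

Section KohnertHexagon.
Variables (B : cells) (p c c' : nat).
Hypotheses (p_gt0 : 0 < p) (lt_cc' : c < c').
Hypotheses (pcB : (p, c) \notin B) (p1cB : (p.+1, c) \notin B).
Hypotheses (pc'B : (p, c') \notin B) (p2c'B : (p.+2, c') \notin B).
Hypothesis row1B : forall k, c < k -> (p.+1, k) \notin B.
Hypothesis row2B : forall k, c' < k -> (p.+2, k) \notin B.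

(** Only the cells in row [i] of column [c] and row [j] of column [c'] will move; [B] stays fixed.
    The hexagon runs from [st p p] to [st p.+1 p.+2], through [st p.+1 p] and [st p.+1 p.+1] on one
    side and [st p p.+1] and [st p p.+2] on the other. *)
Let st i j : cells := (i, c) |` ((j, c') |` B).
Let ok i j := (p <= i <= p.+1) && (p <= j <= p.+2).

Let cc'F : (c == c') = false := ltn_eqF lt_cc'.
Let c'cF : (c' == c) = false := gtn_eqF lt_cc'.

Let mem_stl i j k : (k, c) \in st i j = (k == i) || ((k, c) \in B).
Proof. by rewrite !inE !xpair_eqE eqxx cc'F !andbF andbT. Qed.

Let mem_str i j k : (k, c') \in st i j = (k == j) || ((k, c') \in B).
Proof. by rewrite !inE !xpair_eqE eqxx c'cF !andbF andbT. Qed.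

Let mem_sto i j k k' : k' != c -> k' != c' -> (k, k') \in st i j = ((k, k') \in B).
Proof. by move=> /negbTE h /negbTE h'; rewrite !inE !xpair_eqE h h' !andbF. Qed.

Let notinB i j : ok i j -> (i, c) \notin B /\ (j, c') \notin B.
Proof.
case/andP=> hi hj; split.
  by have [->//|->//] : i = p \/ i = p.+1 by nat_lia.
have [->//|[->|->]//] : j = p \/ j = p.+1 \/ j = p.+2 by nat_lia.
exact: row1B.
Qed.

Let count_st i j k h : ok i j -> count_above (st i j) k h =
  ((c == k) && (h <= i)) + ((c' == k) && (h <= j)) + count_above B k h.
Proof.
move=> /notinB[iB jB]; rewrite !count_above_fset1U ?addnA //.
by rewrite !inE xpair_eqE cc'F andbF (negbTE iB).
Qed.

Let move_l i j : ok i j -> (p, c) |` (st i j `\ (i, c)) = st p j.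
Proof.
move=> /notinB[iB jB]; apply/fsetP => -[k k'].
rewrite mem_move_cell !inE !xpair_eqE.
have [->|k'c] := eqVneq k' c; last by rewrite !andbF.
rewrite !andbT cc'F !andbF /=; have [->|] := eqVneq k i; last by [].
by rewrite (negbTE iB).
Qed.

Let move_r i j j' : ok i j -> (j', c') |` (st i j `\ (j, c')) = st i j'.
Proof.
move=> /notinB[iB jB]; apply/fsetP => -[k k'].
rewrite mem_move_cell !inE !xpair_eqE.
have [->|k'c] := eqVneq k' c'; last by rewrite !andbF.
rewrite !andbT c'cF !andbF /=; have [->|] := eqVneq k j; last by [].
by rewrite (negbTE jB).
Qed.

Let st_l j : ok p j -> j != p.+1 -> st p j \in KD (st p.+1 j).
Proof.
move=> okj jp; have okj1 : ok p.+1 j by move: okj; rewrite /ok; nat_lia.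
rewrite -(move_l okj1); apply: move_cell_KD.
  split=> [|k ck]; first by rewrite mem_stl eqxx.
  have [->|kc'] := eqVneq k c'.
    by rewrite mem_str eq_sym (negbTE jp) row1B.
  by rewrite mem_sto ?row1B // gtn_eqF.
split; [by nat_lia | by rewrite mem_stl (negbTE pcB) orbF; nat_lia | by nat_lia].
Qed.

Let st_r i j : ok i j.+1 -> p <= j -> st i j \in KD (st i j.+1).
Proof.
move=> okj pj; have okj' : ok i j by move: okj; rewrite /ok; nat_lia.
rewrite -(move_r j okj); apply: move_cell_KD; last first.
  split; [by nat_lia | | by nat_lia].
  by rewrite mem_str (negbTE (notinB okj').2) orbF; nat_lia.
split=> [|k ck]; first by rewrite mem_str eqxx.
rewrite mem_sto ?(gtn_eqF ck) ?(gtn_eqF (ltn_trans lt_cc' ck)) //.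
have [->|->] : j = p \/ j = p.+1 by move: okj; rewrite /ok; nat_lia.
  by rewrite row1B // (ltn_trans lt_cc').
exact: row2B.
Qed.

(* Column counts leave only moves towards the bottom st p p; the first of them
   is blocked by a cell (p.+1, c'), which is what disconnects the interval. *)
Let step i j s : ok i j -> st p p \in KD (kohnert_move (st i j) s) ->
  let w := kohnert_move (st i j) s in
  [\/ w = st i j, [/\ i = p.+1, j <> p.+1 & w = st p j],
      j = p.+2 /\ w = st i p.+1 | j = p.+1 /\ w = st i p].
Proof.
move=> okij xw w; have okpp : ok p p by rewrite /ok; nat_lia.
have [wE|[k [s' [[sk right_k] [s's s'k fill] wE]]]] := kohnert_moveP (st i j) s.
  by constructor 1.
(* At these heights the move loses one cell of column [k], yet the result must still dominate
   [st p p]; the contribution of [B] cancels. *)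
have cnt h : s' < h <= s ->
    ((c == k) && (h <= p)) + ((c' == k) && (h <= p)) <
    ((c == k) && (h <= i)) + ((c' == k) && (h <= j)).
  move=> hs; have := count_above_KD k h xw; have := count_above_move_cell k h sk s'k.
  by rewrite -wE !count_st // eqxx /=; nat_lia.
have [ss ss'] : s' < s <= s /\ s' < s'.+1 <= s by split; nat_lia.
have cnts := cnt s ss; have cnts' := cnt s'.+1 ss'.
have [kc|kc] := eqVneq k c.
  rewrite kc eqxx c'cF /= in cnts cnts' sk right_k wE.
  have ijp := okij; rewrite /ok in ijp.
  have [iE sE s'E] : [/\ i = p.+1, s = p.+1 & s' = p] by split; nat_lia.
  constructor 2; split=> // [jE|]; last by rewrite /w wE sE s'E -iE move_l.
  by have := right_k c' lt_cc'; rewrite mem_str sE jE eqxx.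
have [kc'|kc'] := eqVneq k c'; last first.
  by move: cnts; rewrite ![_ == k]eq_sym (negbTE kc) (negbTE kc') /=; nat_lia.
rewrite kc' eqxx cc'F /= in cnts cnts' sk right_k fill wE.
have ijp := okij; rewrite /ok in ijp.
have jE : s = j.
  move: sk; rewrite mem_str; have [//|/=] := eqVneq s j.
  have [->|->] : s = p.+1 \/ s = p.+2 by nat_lia.
    by rewrite (negbTE (row1B lt_cc')).
  by rewrite (negbTE p2c'B).
have [jp|jp] : j = p.+1 \/ j = p.+2 by nat_lia.
  by constructor 4; split=> //; rewrite /w wE jE move_r //; congr st; nat_lia.
constructor 3; split=> //; rewrite /w wE jE move_r //; congr st.
(* A jump from row [p.+2] to row [p] would need a cell in row [p.+1] of column [c']. *)
have [//|s'E] : s' = p.+1 \/ s' = p by nat_lia.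
have fp : s' < p.+1 < s by nat_lia.
by have := fill _ fp; rewrite mem_str (negbTE (row1B lt_cc')); nat_lia.
Qed.

(** All diagrams along the way remain above [st p p], so [step] applies to each move. Varying [Q]
    describes the whole interval as well as the parts below its two coatoms. *)
Let closed_reach (Q : nat -> nat -> Prop) :
  (forall i j, Q i j -> ok i j) ->
  (forall j, Q p.+1 j -> j <> p.+1 -> Q p j) ->
  (forall i, Q i p.+2 -> Q i p.+1) -> (forall i, Q i p.+1 -> Q i p) ->
  forall i j w, Q i j -> w \in KD (st i j) -> st p p \in KD w ->
  exists i' j', Q i' j' /\ w = st i' j'.
Proof.
move=> Qok Q1 Q2 Q3 i j w Qij /KDP[rs ->]; elim: rs => [|s rs IHrs] in i j Qij *.
  by move=> _; exists i, j.
move=> /= xw.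
have xs : st p p \in KD (kohnert_move (st i j) s).
  by apply: KD_trans xw; apply/KDP; exists rs.
move: xw; have [->|[iE jE ->]|[jE ->]|[jE ->]] := step (Qok _ _ Qij) xs;
  apply: IHrs => //.
- by apply: Q1 => //; rewrite -iE.
- by apply: Q2; rewrite -jE.
- by apply: Q3; rewrite -jE.
Qed.

Lemma kohnert_states_hexagon D : st p.+1 p.+2 \in KD D ->
  exists x a b a' b' y : kohnert_poset D, hexagon x a b a' b' y.
Proof.
move=> yD.
have by_ : st p.+1 p.+1 \in KD (st p.+1 p.+2) by apply: st_r; rewrite /ok; nat_lia.
have ab : st p.+1 p \in KD (st p.+1 p.+1) by apply: st_r; rewrite /ok; nat_lia.
have xa : st p p \in KD (st p.+1 p) by apply: st_l; rewrite /ok; nat_lia.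
have by' : st p p.+2 \in KD (st p.+1 p.+2) by apply: st_l; rewrite /ok; nat_lia.
have ab' : st p p.+1 \in KD (st p p.+2) by apply: st_r; rewrite /ok; nat_lia.
have xa' : st p p \in KD (st p p.+1) by apply: st_r; rewrite /ok; nat_lia.
have bD := KD_trans yD by_; have aD := KD_trans bD ab; have xD := KD_trans aD xa.
have bD' := KD_trans yD by'; have aD' := KD_trans bD' ab'.
pose el E (ED : E \in KD D) : kohnert_poset D := exist _ E ED.
have meml i j : (p.+1, c) \in st i j = (i == p.+1).
  by rewrite mem_stl (negbTE p1cB) orbF eq_sym.
have memr i j : (p, c') \in st i j = (j == p).
  by rewrite mem_str (negbTE pc'B) orbF eq_sym.
have memr1 i j : (p.+1, c') \in st i j = (j == p.+1).
  by rewrite mem_str (negbTE (row1B lt_cc')) orbF eq_sym.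
have el_lt E F (ED : E \in KD D) (FD : F \in KD D) :
    E \in KD F -> E <> F -> (el E ED < el F FD)%O.
  by move=> EF ne; rewrite lt_neqAle; apply/andP; split=> //; apply/eqP => -[].
have stE i j i' j' : st i j = st i' j' ->
    [/\ (i == p.+1) = (i' == p.+1), (j == p) = (j' == p) & (j == p.+1) = (j' == p.+1)].
  by move=> e; rewrite -(meml i j) -(memr i j) -(memr1 i j) e meml memr memr1.
exists (el _ xD), (el _ aD), (el _ bD), (el _ aD'), (el _ bD'), (el _ yD); split.
- by apply/and3P; split; apply: el_lt => // /stE[]; nat_lia.
- by apply/and3P; split; apply: el_lt => // /stE[]; nat_lia.
- move=> z xz zy.
  have xz_ : st p p \in KD (val z) := ltW xz.
  have zy_ : val z \in KD (st p.+1 p.+2) := ltW zy.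
  have [|||||i [j [okij zE]]] := closed_reach (Q := ok) _ _ _ _ _ zy_ xz_;
    rewrite /ok //; try by move=> *; nat_lia.
  have zx : ~ (i = p /\ j = p).
    by move=> [ip jp]; move: xz; rewrite (_ : z = el _ xD) ?ltxx //;
       apply: val_inj; rewrite zE ip jp.
  have zny : ~ (i = p.+1 /\ j = p.+2).
    by move=> [ip jp]; move: zy; rewrite (_ : z = el _ yD) ?ltxx //;
       apply: val_inj; rewrite zE ip jp.
  have elE i' j' (h : st i' j' \in KD D) : i = i' -> j = j' -> z == el _ h.
    by move=> ii jj; apply/eqP/val_inj; rewrite zE ii jj.
  have : [\/ i = p.+1 /\ j = p, i = p.+1 /\ j = p.+1, i = p /\ j = p.+1
           | i = p /\ j = p.+2].
    move: okij; rewrite /ok => okij.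
    have hj : j = p \/ j = p.+1 \/ j = p.+2 by nat_lia.
    have [ip|ip] : i = p \/ i = p.+1 by nat_lia.
      by case: hj => [jp|[jp|jp]]; [case: zx | constructor 3 | constructor 4].
    by case: hj => [jp|[jp|jp]]; [constructor 1 | constructor 2 | case: zny].
  by rewrite !inE; case=> -[ip jp]; rewrite (elE _ _ _ ip jp) ?orbT.
(* Once the left cell is in row [p] it stays there, so nothing on the first side lies below the
   second. *)
have upper u : st p p \in KD u -> u \in KD (st p p.+2) -> (p.+1, c) \notin u.
  move=> xu ub; have [|||||i [j [[_ ip] ->]]] :=
    closed_reach (Q := fun i j => ok i j /\ i = p) _ _ _ _ _ ub xu;
    rewrite /ok //; try by move=> *; nat_lia.
  by rewrite meml; nat_lia.
(* Starting from [st p.+1 p.+1], the left cell is blocked until the right one reaches row [p], so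
   nothing on the second side lies below the first. *)
have lower u : st p p \in KD u -> u \in KD (st p.+1 p.+1) ->
    ((p.+1, c) \in u) || ((p, c') \in u).
  move=> xu ub; have [|||||i [j [[okij ip] ->]]] :=
    closed_reach (Q := fun i j => ok i j /\
      (i = p.+1 /\ j <= p.+1 \/ j = p)) _ _ _ _ _ ub xu;
    rewrite /ok //; try by move=> *; nat_lia.
  by rewrite meml memr; nat_lia.
move=> u v ui vi; rewrite /Order.comparable negb_or; apply/andP; split; apply/negP.
- rewrite /Order.le /= /kohnert_le => uv.
  have [xu uc] : st p p \in KD (val u) /\ (p.+1, c) \in val u.
    by move: ui; rewrite in_cons mem_seq1 => /orP[]/eqP->; rewrite /= meml eqxx; split=> //;
       exact: KD_trans xa.
  have vb : val v \in KD (st p p.+2).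
    by move: vi; rewrite in_cons mem_seq1 => /orP[]/eqP->; rewrite //= KD_refl.
  by have := upper _ xu (KD_trans vb uv); rewrite uc.
- rewrite /Order.le /= /kohnert_le => vu.
  have [xv vc] : st p p \in KD (val v) /\
      ~~ (((p.+1, c) \in val v) || ((p, c') \in val v)).
    move: vi; rewrite in_cons mem_seq1 => /orP[]/eqP->; rewrite /= meml memr; split=> //; try nat_lia.
    exact: KD_trans xa'.
  have ub : val u \in KD (st p.+1 p.+1).
    by move: ui; rewrite in_cons mem_seq1 => /orP[]/eqP->; rewrite //= KD_refl.
  by case/negP: vc; exact: lower (KD_trans ub vu).
Qed.

End KohnertHexagon.

(** * Reaching a hexagon from a diagram that is not a hook diagram *)

Definition has_hexagon D :=
  exists x a b a' b' y : kohnert_poset D, hexagon x a b a' b' y.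

Lemma local_hexagon D E r c c' : E \in KD D -> 1 < r -> c < c' ->
  (r, c) \in E -> (r.-1, c) \notin E -> (r.+1, c') \in E -> (r.-1, c') \notin E ->
  (forall k, c < k -> (r, k) \notin E) ->
  (forall k, c' < k -> (r.+1, k) \notin E) -> has_hexagon D.
Proof.
case: r => [|p] // ED p0 cc' rE pE r1E pE' row row1.
pose B := (E `\ (p.+1, c)) `\ (p.+2, c').
have EE : (p.+1, c) |` ((p.+2, c') |` B) = E.
  apply/fsetP => x; rewrite !inE.
  have [->|_] := eqVneq x (p.+1, c); first by rewrite rE.
  by have [->|_] := eqVneq x (p.+2, c'); rewrite ?r1E.
rewrite -EE in ED; apply: kohnert_states_hexagon ED => //.
- by rewrite !inE (negbTE pE) !andbF.
- by rewrite !inE eqxx /= andbF.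
- by rewrite !inE (negbTE pE') !andbF.
- by rewrite !inE eqxx.
- by move=> k ck; rewrite !inE (negbTE (row k ck)) !andbF.
- by move=> k ck; rewrite !inE (negbTE (row1 k ck)) !andbF.
Qed.

(** From column [c'] on, row [r] and then row [r.-1] are cleared into the free space below. Row
    [r.+1] and the columns left of [c'] are untouched, so [local_hexagon] applies. Two free rows
    serve the two successive clearings. *)
Lemma local_hexagon_free_rows D E r c c' : E \in KD D -> 1 < r -> c < c' ->
  (r, c) \in E -> (r.-1, c) \notin E -> (r.+1, c') \in E ->
  (forall k, c < k < c' -> (r, k) \notin E) ->
  (forall k, c' < k -> (r.+1, k) \notin E) ->
  (forall k, c' <= k -> (1, k) \notin E /\ (2, k) \notin E) -> has_hexagon D.
Proof.
move=> ED r1 cc' rE pE r1E between row1 free.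
have [|E1 E1E hE1] := @clear_row_KD E r c'.
  move=> k ck rkE; exists 1; last exact: (free k ck).1.
  by have [r2|] := eqVneq r 2; [rewrite r2 (negbTE (free k ck).2) in rkE | lia].
(* A cell of row [r] could land in row 1 only if row 2 were occupied there, or were row [r]
   itself. *)
have free1 k : c' <= k -> (1, k) \notin E1.
  move=> ck; have := hE1 k; rewrite ck /=; case: ifP => [rkE [r' [r'r r'E fill] h]|_ ->].
    rewrite h (negbTE (free k ck).1) andbF orbF; apply/negP => /eqP r'1.
    have [r2|r2] := eqVneq r 2; first by rewrite r2 (negbTE (free k ck).2) in rkE.
    by have := fill 2; rewrite (negbTE (free k ck).2) -r'1; nat_lia.
  exact: (free k ck).1.
have row_r k : c' <= k -> (r, k) \notin E1.
  move=> ck; have := hE1 k; rewrite ck /=; case: ifP => [_ [r' [r'r _ _] ->]|+ ->] //.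
    by rewrite eqxx; nat_lia.
  by move=> ->.
have left1 k i : k < c' -> ((i, k) \in E1) = ((i, k) \in E).
  by move=> kc; have := hE1 k; rewrite leqNgt kc /= => ->.
have up1 k : ((r.+1, k) \in E1) = ((r.+1, k) \in E).
  have := hE1 k; case: ifP => [_ [r' [r'r _ _] ->]|_ ->//].
  by rewrite !gtn_eqF //; nat_lia.
have [|E2 E2E1 hE2] := @clear_row_KD E1 r.-1 c'.
  move=> k ck rkE; exists 1; last exact: free1.
  by have [r2|] := eqVneq r.-1 1; [rewrite r2 (negbTE (free1 k ck)) in rkE | nat_lia].
have up2 k i : r <= i -> ((i, k) \in E2) = ((i, k) \in E1).
  move=> ri; have := hE2 k; case: ifP => [_ [r' [r'r _ _] ->]|_ ->//].
  by rewrite !gtn_eqF //; nat_lia.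
have left2 k i : k < c' -> ((i, k) \in E2) = ((i, k) \in E1).
  by move=> kc; have := hE2 k; rewrite leqNgt kc /= => ->.
apply: (@local_hexagon D E2 r c c') => //.
- exact: KD_trans ED (KD_trans E1E E2E1).
- by rewrite left2 // left1.
- by rewrite left2 // left1.
- by rewrite up2 // up1.
- have := hE2 c'; rewrite leqnn /=; case: ifP => [_ [r' [r'r _ _] ->]|+ ->] //.
    by rewrite eqxx orbF; nat_lia.
  by move=> ->.
- move=> k ck; rewrite up2 //; have [kc|ck'] := ltnP k c'; last exact: row_r.
  by rewrite left1 // between ?ck.
- by move=> k ck; rewrite up2 // up1 row1.
Qed.

(** Intrinsic form of hook diagrams: no ascents, and no column with several cells except the last
    one. The empty diagram is included. *)
Definition hooklike D :=
  {in D &, forall x y, x.2 < y.2 -> y.1 <= x.1} /\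
  {in D & &, forall x y z, x.2 = y.2 -> x <> y -> z.2 <= x.2}.

Lemma ex_max_nat (P : nat -> Prop) b : (exists n, P n) -> (forall n, P n -> n <= b) ->
  exists n, P n /\ forall m, P m -> m <= n.
Proof.
move=> [n0 Pn0] ub.
have ex : exists n, `[< P n >] by exists n0; apply/asboolP.
have ubb n : `[< P n >] -> n <= b by move/asboolP/ub.
case: (ex_maxnP ex ubb) => n /asboolP Pn max.
by exists n; split=> // m Pm; apply: max; apply/asboolP.
Qed.

Lemma ex_min_nat (P : nat -> Prop) : (exists n, P n) ->
  exists n, P n /\ forall m, P m -> n <= m.
Proof.
move=> [n0 Pn0].
have ex : exists n, `[< P n >] by exists n0; apply/asboolP.
case: (ex_minnP ex) => n /asboolP Pn min.
by exists n; split=> // m Pm; apply: min; apply/asboolP.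
Qed.

Lemma row_ub D r c : (r, c) \in D -> r <= \max_(x <- D) x.1.
Proof. by move=> h; apply: (leq_bigmax_seq (F := fst) (r, c)). Qed.

Lemma column_ub D r c : (r, c) \in D -> c <= \max_(x <- D) x.2.
Proof. by move=> h; apply: (leq_bigmax_seq (F := snd) (r, c)). Qed.

(* With c' the largest possible column, every cell to its right is weakly lower
   than every cell to its left. *)
Lemma last_ascent D : (exists r c r' c', [/\ (r, c) \in D, (r', c') \in D,
    c < c' & r < r']) ->
  exists c', (exists r c r', [/\ (r, c) \in D, (r', c') \in D, c < c' & r < r']) /\
    forall r c r' k, (r, c) \in D -> (r', k) \in D -> c < c' -> c' < k -> r' <= r.
Proof.
move=> [r [c [r' [c' asc]]]].
have [||m [Pm maxm]] := @ex_max_nat (fun c' => exists r c r',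
    [/\ (r, c) \in D, (r', c') \in D, c < c' & r < r']) (\max_(x <- D) x.2).
- by exists c', r, c, r'.
- by move=> n [? [? [? [_ /column_ub]]]].
exists m; split=> // r0 c0 r1 k r0D r1D cm mk; rewrite leqNgt; apply/negP => lt_r.
suff /maxm : exists r c r', [/\ (r, c) \in D, (r', k) \in D, c < k & r < r'].
  by rewrite leqNgt mk.
by exists r0, c0, r1; split=> //; exact: ltn_trans mk.
Qed.

(** The extremal choices provide the free positions: the last [c'] keeps cells further right low,
    the lowest [r] frees the position under the left cell, the rightmost [c] empties row [r] between
    the columns, and the lowest [s] lets the right cell drop to row [r.+1]. *)
Lemma ascent_hexagon_free_rows D :
  (forall r c, (r, c) \in D -> 2 < r) ->
  (exists r c r' c', [/\ (r, c) \in D, (r', c') \in D, c < c' & r < r']) ->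
  has_hexagon D.
Proof.
move=> rows /last_ascent[c' [[r0 [c0 [r1 [r0D r1D c0c' r01]]]] right_low]].
have [|r [[c1 [c1c' rc1D]] minr]] :=
  @ex_min_nat (fun r => exists c, c < c' /\ (r, c) \in D); first by exists r0, c0.
have [||c [[cc' rcD] maxc]] :=
    @ex_max_nat (fun c => c < c' /\ (r, c) \in D) (\max_(x <- D) x.2).
- by exists c1.
- by move=> n [_ /column_ub].
have [|s [[rs sD] mins]] := @ex_min_nat (fun s => r < s /\ (s, c') \in D).
  by exists r1; split=> //; apply: leq_ltn_trans r01; apply: minr; exists c0.
have r2 := rows _ _ rcD.
pose E := (r.+1, c') |` (D `\ (s, c')).
have right_free k j : c' < k -> r < j -> (j, k) \notin D.
  move=> ck rj; apply/negP => jD.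
  by have := right_low _ _ _ _ rcD jD cc' ck; rewrite leqNgt rj.
have ED : E \in KD D.
  apply: drop_cell_KD => //.
    move=> j jr; apply/negP => jD; have : s <= j by apply: mins; split=> //; nat_lia.
    by nat_lia.
  by move=> k j ck jr; apply: right_free => //; nat_lia.
have Ek k j : k != c' -> ((j, k) \in E) = ((j, k) \in D).
  by move=> kc; rewrite mem_move_cell !xpair_eqE (negbTE kc) !andbF.
apply: (@local_hexagon_free_rows D E r c c') => //.
- by nat_lia.
- by rewrite Ek ?ltn_eqF.
- rewrite Ek ?ltn_eqF //; apply/negP => rD.
  by have : r <= r.-1; [apply: minr; exists c | nat_lia].
- by rewrite mem_move_cell eqxx.
- move=> k /andP[ck kc']; rewrite Ek ?ltn_eqF //; apply/negP => kD.
  by have : k <= c; [apply: maxc | nat_lia].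
- by move=> k ck; rewrite Ek ?gtn_eqF // right_free.
- move=> k _; rewrite !mem_move_cell !xpair_eqE.
  by split; apply/negP => /orP[/andP[]|/andP[_ /rows]]; nat_lia.
Qed.

(* Without ascents, the second lowest cell of column c jumps over the lowest one
   to create an ascent. *)
Lemma double_column_hexagon D :
  (forall r c, (r, c) \in D -> 2 < r) ->
  {in D &, forall x y, x.2 < y.2 -> y.1 <= x.1} ->
  (exists r r' r'' c k, [/\ (r, c) \in D, (r', c) \in D, r < r',
     (r'', k) \in D & c < k]) ->
  has_hexagon D.
Proof.
move=> rows noasc [r [r' [r'' [c [k [rD r'D rr' r''D ck]]]]]].
have {}noasc i m j n : (i, m) \in D -> (j, n) \in D -> m < n -> j <= i.
  by move=> iD jD mn; exact: (noasc _ _ iD jD mn).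
have [|a [aD mina]] := @ex_min_nat (fun a => (a, c) \in D); first by exists r.
have [|b [[ab bD] minb]] := @ex_min_nat (fun b => a < b /\ (b, c) \in D).
  by exists r'; split=> //; apply: leq_ltn_trans rr'; exact: mina.
have [||t [[k0 [ck0 tk0]] maxt]] :=
    @ex_max_nat (fun t => exists k, c < k /\ (t, k) \in D) (\max_(x <- D) x.1).
- by exists r'', k.
- by move=> n [k' [_ /row_ub]].
have [||c' [[cc' tD] maxc']] :=
    @ex_max_nat (fun k => c < k /\ (t, k) \in D) (\max_(x <- D) x.2).
- by exists k0.
- by move=> n [_ /column_ub].
have ta : t <= a by exact: noasc aD tD cc'.
have t3 := rows _ _ tD.
have right_free j m : c < m -> t < j -> (j, m) \notin D.
  move=> cm tj; apply/negP => jD; have : j <= t by apply: maxt; exists m.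
  by rewrite leqNgt tj.
have ne m : c < m -> m != c by move=> cm; rewrite gtn_eqF.
(* Here [t] is the highest row occupied to the right of column [c]. The lowest cell of column [c]
   drops to row [t], the next one to row [t.+1], and the latter then jumps to row [t.-1], forming an
   ascent with the cell in row [t] of column [c']. *)
pose E1 := (t, c) |` (D `\ (a, c)).
have E1D : E1 \in KD D.
  apply: drop_cell_KD => //; first by nat_lia.
    move=> j jr; apply/negP => jD; have : a <= j by exact: mina.
    by nat_lia.
  by move=> m j cm jr; apply: right_free => //; nat_lia.
have E1o m j : m != c -> ((j, m) \in E1) = ((j, m) \in D).
  by move=> mc; rewrite mem_move_cell !xpair_eqE (negbTE mc) !andbF.
have E1c j : ((j, c) \in E1) = (j == t) || (j != a) && ((j, c) \in D).
  by rewrite mem_move_cell !xpair_eqE !eqxx !andbT.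
have low j : j != a -> j < b -> (j, c) \notin D.
  move=> ja jb; apply/negP => jD; have aj : a <= j by exact: mina.
  have : b <= j by apply: minb; split=> //; nat_lia.
  by nat_lia.
pose E2 := (t.+1, c) |` (E1 `\ (b, c)).
have E2E1 : E2 \in KD E1.
  apply: drop_cell_KD => //.
  - by rewrite E1c bD andbT; nat_lia.
  - by nat_lia.
  - move=> j jr; rewrite E1c; have [ja|ja] := eqVneq j a; first by rewrite orbF; nat_lia.
    by rewrite (negbTE (low j _ _)) //=; nat_lia.
  - by move=> m j cm jr; rewrite E1o ?ne // right_free //; nat_lia.
have E2o m j : m != c -> ((j, m) \in E2) = ((j, m) \in D).
  by move=> mc; rewrite mem_move_cell !xpair_eqE (negbTE mc) !andbF E1o.
have E2c j : ((j, c) \in E2) = [|| j == t.+1, j == t | [&& j != b, j != a & (j, c) \in D]].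
  rewrite mem_move_cell !xpair_eqE !eqxx !andbT E1c.
  by have [jb|] := eqVneq j b; rewrite //= orbF; nat_lia.
pose E3 := (t.-1, c) |` (E2 `\ (t.+1, c)).
have lowE2 j : j < t -> (j, c) \notin E2.
  move=> jt; rewrite E2c; have [ja|ja] := eqVneq j a; first by nat_lia.
  by rewrite (negbTE (low j _ _)) //= ?andbF; nat_lia.
have E3E2 : E3 \in KD E2.
  apply: move_cell_KD.
    split=> [|m cm]; first by rewrite E2c eqxx.
    by rewrite E2o ?ne // right_free.
  split; [by nat_lia | by apply: lowE2; nat_lia |].
  by move=> j jr; rewrite E2c (_ : j == t) ?orbT //; nat_lia.
have E3o m j : m != c -> ((j, m) \in E3) = ((j, m) \in D).
  by move=> mc; rewrite mem_move_cell !xpair_eqE (negbTE mc) !andbF E2o.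
apply: (@local_hexagon_free_rows D E3 t.-1 c c') => //.
- exact: KD_trans E1D (KD_trans E2E1 E3E2).
- by nat_lia.
- by rewrite mem_move_cell eqxx.
- rewrite mem_move_cell !xpair_eqE eqxx (negbTE (lowE2 _ _)); last by nat_lia.
  by rewrite !andbF orbF andbT; nat_lia.
- by rewrite E3o ?ne // prednK //; nat_lia.
- move=> m /andP[cm mc']; rewrite E3o ?ne //; apply/negP => mD.
  by have := noasc _ _ _ _ mD tD mc'; nat_lia.
- move=> m c'm; have cm := ltn_trans cc' c'm; rewrite E3o ?ne // prednK; last by nat_lia.
  by apply/negP => mD; have : m <= c'; [apply: maxc' | nat_lia].
- move=> m c'm; have cm := leq_trans cc' c'm; rewrite !E3o ?ne //.
  by split; apply/negP => /rows.
Qed.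

Lemma not_hooklike_cases D : ~ hooklike D ->
  (exists r c r' c', [/\ (r, c) \in D, (r', c') \in D, c < c' & r < r']) \/
  ({in D &, forall x y, x.2 < y.2 -> y.1 <= x.1} /\
   exists r r' r'' c k, [/\ (r, c) \in D, (r', c) \in D, r < r',
     (r'', k) \in D & c < k]).
Proof.
move=> nh; have [asc|nasc] := pselect (exists r c r' c',
    [/\ (r, c) \in D, (r', c') \in D, c < c' & r < r']); [by left | right].
have noasc : {in D &, forall x y, x.2 < y.2 -> y.1 <= x.1}.
  move=> [r c] [r' c'] xD yD /= cc'; rewrite leqNgt; apply/negP => rr'.
  by apply: nasc; exists r, c, r', c'.
split=> //; apply: contrapT => nd; apply: nh; split=> //.
move=> [r c] [r' c'] [r'' k] xD yD zD /= cc' ne; rewrite leqNgt; apply/negP => ck.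
rewrite -cc' in yD; apply: nd.
case: (ltngtP r r') => rr'; last by case: ne; rewrite rr' cc'.
  by exists r, r', r'', c, k.
by exists r', r, r'', c, k.
Qed.

Lemma not_hooklike_hexagon_free_rows D : (forall r c, (r, c) \in D -> 2 < r) ->
  ~ hooklike D -> has_hexagon D.
Proof.
move=> rows /not_hooklike_cases[|[]].
  exact: ascent_hexagon_free_rows.
exact: double_column_hexagon.
Qed.

(** With one cell per column the position directly below any cell above row 1 is free, so clearing
    row [r] to the right of [c'] needs no empty rows. Working above row 1 ensures that row [r.-1]
    exists. *)
Lemma not_hooklike_hexagon_single D : diagram D ->
  (forall r r' c, (r, c) \in D -> (r', c) \in D -> r = r') ->
  ~ hooklike (D `\` row_of D 1) -> has_hexagon D.
Proof.
move=> diagD single.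
have memD' r c : ((r, c) \in D `\` row_of D 1) = ((r, c) \in D) && (1 < r).
  rewrite !inE /=; case: (boolP ((r, c) \in D)) => rD; rewrite ?andbF //= andbT.
  by have [/= r0 _] := diagD _ rD; lia.
case/not_hooklike_cases => [/last_ascent|[_]]; last first.
  case=> [r [r' [r'' [c [k []]]]]]; rewrite !memD' => /andP[rD _] /andP[r'D _] rr'.
  by rewrite (single _ _ _ rD r'D) ltnn in rr'.
move=> [c' [[r [c0 [s []]]]]].
rewrite !memD' => /andP[rc0D r1] /andP[sD s1] c0c' rs right_low.
have [||c [[cc' rcD] maxc]] :=
    @ex_max_nat (fun c => c < c' /\ (r, c) \in D) (\max_(x <- D) x.2).
- by exists c0.
- by move=> n [_ /column_ub].
have right_free k j : c' < k -> r < j -> (j, k) \notin D.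
  move=> ck rj; apply/negP => jD; have := right_low r c j k.
  by rewrite !memD' rcD jD r1 (ltn_trans r1 rj) => /(_ isT isT cc' ck); nat_lia.
pose E := (r.+1, c') |` (D `\ (s, c')).
have ED : E \in KD D.
  apply: drop_cell_KD => //.
    move=> j jr; apply/negP => jD.
    by have := single _ _ _ sD jD; nat_lia.
  by move=> k j ck jr; apply: right_free => //; nat_lia.
have Ek k j : k != c' -> ((j, k) \in E) = ((j, k) \in D).
  by move=> kc; rewrite mem_move_cell !xpair_eqE (negbTE kc) !andbF.
have Ec' j : ((j, c') \in E) = (j == r.+1).
  rewrite mem_move_cell !xpair_eqE !eqxx !andbT; case: (boolP ((j, c') \in D)) => jD.
    by rewrite (single _ _ _ jD sD) eqxx !orbF.
  by rewrite andbF orbF.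
have [|E' E'E hE'] := @clear_row_KD E r c'.+1.
  move=> k ck; rewrite Ek ?gtn_eqF // => rkD; exists r.-1; first by nat_lia.
  rewrite Ek ?gtn_eqF //; apply/negP => pD.
  by have := single _ _ _ rkD pD; nat_lia.
have left k j : k <= c' -> ((j, k) \in E') = ((j, k) \in E).
  by move=> kc; have := hE' k; rewrite ltnNge kc.
apply: (@local_hexagon D E' r c c') => //.
- exact: KD_trans E'E.
- by rewrite left ?Ek ?ltn_eqF // ltnW.
- rewrite left ?Ek ?ltn_eqF ?(ltnW cc') //; apply/negP => pD.
  by have := single _ _ _ rcD pD; nat_lia.
- by rewrite left // Ec'.
- by rewrite left // Ec'; nat_lia.
- move=> k ck; case: (ltngtP k c') => [kc'|c'k|->].
  + rewrite left ?Ek ?ltn_eqF ?(ltnW kc') //; apply/negP => kD.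
    by have : k <= c; [apply: maxc | nat_lia].
  + have := hE' k; rewrite c'k /=; case: ifP => [_ [q [qr _ _] ->]|+ ->].
      by rewrite eqxx; nat_lia.
    by move=> ->.
  + by rewrite left // Ec'; nat_lia.
- move=> k ck; have kE : (r.+1, k) \notin E by rewrite Ek ?gtn_eqF // right_free.
  have := hE' k; rewrite ck /=; case: ifP => [_ [q [qr _ _] ->]|_ ->//].
  by rewrite (negbTE kE) andbF orbF; nat_lia.
Qed.

(** * Hook diagrams as sequences *)

Section HookSequences.
Variables (R : cells) (N : nat) (col : nat -> nat).
Implicit Types (f g : nat -> nat).

(* Cell i lies in row f i of column col i; cells are listed from left to right,
   and from top to bottom within the last column, the only one with several cells.
   The cells of R lie in row 1 and never move. *)
Definition hook_columns :=
  (forall i j, i <= j -> j < N -> col i <= col j) /\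
  (forall i j k, i < N -> j < N -> k < N -> i <> j -> col i = col j -> col k <= col i).

Definition hook_rows f :=
  [/\ forall i, i < N -> 0 < f i, forall i j, i < j -> j < N -> f j <= f i
    & forall i j, i < j -> j < N -> col i = col j -> f j < f i].

Definition seq_diagram f : cells := R `|` [fset (f i, col i) | i in iota 0 N].

Lemma seq_diagramP f r c :
  reflect ((r, c) \in R \/ exists i, [/\ i < N, f i = r & col i = c])
          ((r, c) \in seq_diagram f).
Proof.
rewrite in_fsetU; apply: (iffP orP) => -[|]; try by left.
  by case/imfsetP => i /=; rewrite mem_iota => iN [-> ->]; right; exists i.
by case=> i [iN <- <-]; right; apply/imfsetP; exists i; rewrite //= mem_iota.
Qed.

Lemma seq_diagram_ext f g : (forall i, i < N -> f i = g i) ->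
  seq_diagram f = seq_diagram g.
Proof.
move=> fg; apply/fsetP => -[r c]; apply/seq_diagramP/seq_diagramP;
  case=> [|[i [iN <- <-]]]; try by left.
  by right; exists i; split; rewrite ?fg.
by right; exists i; split; rewrite ?fg.
Qed.

Hypothesis row1R : forall x, x \in R -> x.1 = 1.
Hypothesis colR : forall x i, x \in R -> i < N -> col i <> x.2.
Hypothesis cols : hook_columns.

Let seq_diagram_col f r i : i < N -> (r, col i) \in seq_diagram f ->
  exists j, [/\ j < N, f j = r & col j = col i].
Proof. by move=> iN /seq_diagramP[/colR/(_ iN)|]. Qed.

Let mem_seq_diagram f i : i < N -> (f i, col i) \in seq_diagram f.
Proof. by move=> iN; apply/seq_diagramP; right; exists i. Qed.

(** At the first difference, the larger entry must occur in the other sequence at an earlier index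
    of the same column. Both sequences agree there, so one of them would repeat a row within a
    column. *)
Lemma seq_diagram_inj f g : hook_rows f -> hook_rows g ->
  seq_diagram f = seq_diagram g -> forall i, i < N -> f i = g i.
Proof.
suff le f1 f2 i : hook_rows f1 -> hook_rows f2 -> seq_diagram f1 = seq_diagram f2 ->
    i < N -> (forall j, j < i -> f1 j = f2 j) -> f1 i <= f2 i.
  move=> vf vg fg; elim/ltn_ind => i IHi iN.
  apply/eqP; rewrite eqn_leq; apply/andP; split; apply: le => // j ji;
    by rewrite IHi ?(ltn_trans ji iN).
move=> [_ dec1 sdec1] [_ dec2 sdec2] e iN eqj; rewrite leqNgt; apply/negP => lti.
have : (f1 i, col i) \in seq_diagram f2 by rewrite -e mem_seq_diagram.
case/(seq_diagram_col iN) => j [jN f2j colj].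
have ji : j < i.
  rewrite ltnNge leq_eqVlt; apply/negP => /predU1P[ij|ij].
    by rewrite -ij in f2j; rewrite f2j ltnn in lti.
  by have := dec2 _ _ ij jN; rewrite f2j leqNgt lti.
by have := sdec1 _ _ ji iN colj; rewrite (eqj _ ji) f2j ltnn.
Qed.

(* Jumping from r to r' in column c shifts the whole run r'+1, ..., r by one. *)
Lemma seq_diagram_move f r : hook_rows f -> exists g,
  [/\ hook_rows g, forall i, i < N -> g i <= f i
    & kohnert_move (seq_diagram f) r = seq_diagram g].
Proof.
move=> vf; have [pos dec sdec] := vf.
have [->|[c [r' [[rE right_c] [r'r r'E fill] ->]]]] :=
  kohnert_moveP (seq_diagram f) r; first by exists f.
have rNR : (r, c) \notin R by apply/negP => /row1R /=; lia.
have [i [iN fi coli]] : exists i, [/\ i < N, f i = r & col i = c].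
  by case/seq_diagramP: rE => // rR; rewrite rR in rNR.
have run a : r' < a <= r -> exists j, [/\ j < N, f j = a & col j = c].
  move=> ar; have : (a, col i) \in seq_diagram f.
    rewrite coli; have [->//|ne] := eqVneq a r; apply: fill; lia.
  by case/(seq_diagram_col iN) => j [jN fj colj]; exists j; rewrite colj.
have nor' j : j < N -> col j = c -> f j <> r'.
  by move=> jN colj fj; case/negP: r'E; rewrite -fj -colj mem_seq_diagram.
pose P j := (col j == c) && (r' < f j <= r).
pose g j := if P j then (f j).-1 else f j.
have gP j : P j -> g j = (f j).-1 by rewrite /g => ->.
have gN j : ~~ P j -> g j = f j by rewrite /g => /negbTE->.
exists g; split.
- split=> [j jN|j k jk kN|j k jk kN ejk].
  + rewrite /g; case: ifP => [/andP[_]|_]; last exact: pos.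
    by move: r'r; clear; lia.
  + have jN := ltn_trans jk kN; have lekj := dec _ _ jk kN.
    have lek : g k <= f k by rewrite /g; case: ifP; rewrite ?leq_pred.
    have [Pj|Pj] := boolP (P j); last by rewrite (gN _ Pj) (leq_trans lek).
    rewrite (gP _ Pj).
    have [lt_kj|eq_kj] : f k < f j \/ f k = f j by move: lekj; clear; lia.
      by apply: leq_trans lek _; move: lt_kj; clear; lia.
    case/andP: Pj => /eqP colj fjr.
    (* A later cell in the row of [j] must lie in column [c] too. Otherwise it is to the right of
       the moved cell in row [r], or, if [f j] is not [r], column [c] has two cells and is already
       the last. *)
    suff Pk : P k by rewrite (gP _ Pk) eq_kj.
    rewrite /P eq_kj fjr andbT; apply/eqP.
    have := cols.1 _ _ (ltnW jk) kN; rewrite leq_eqVlt => /predU1P[<-//|lt_col].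
    have [fjE|fjE] := eqVneq (f j) r.
      have /right_c/negP[] : c < col k by rewrite -colj.
      by rewrite -fjE -eq_kj mem_seq_diagram.
    have ij : i <> j by move=> ij; rewrite -ij fi eqxx in fjE.
    have := cols.2 i j k iN jN kN ij; rewrite coli colj => /(_ erefl) kc.
    by move: lt_col; rewrite colj ltnNge kc.
  + have jN := ltn_trans jk kN; have lt_kj := sdec _ _ jk kN ejk.
    have lek : g k <= f k by rewrite /g; case: ifP; rewrite ?leq_pred.
    have [Pj|Pj] := boolP (P j); last by rewrite (gN _ Pj) (leq_ltn_trans lek).
    rewrite (gP _ Pj); have [Pk|Pk] := boolP (P k).
      by rewrite (gP _ Pk); case/andP: Pk => _; move: lt_kj; clear; lia.
    rewrite (gN _ Pk); case/andP: Pj => /eqP colj fjr.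
    have fk : f k <> r' by apply: nor' => //; rewrite -ejk.
    move: Pk; rewrite /P -ejk colj eqxx /=.
    by move: fk fjr lt_kj; clear; lia.
- by move=> j jN; rewrite /g; case: ifP; rewrite ?leq_pred.
apply/fsetP => -[a k]; rewrite mem_move_cell; apply/orP/seq_diagramP => [[/eqP[-> ->]|]|].
- have [|j [jN fj colj]] := run r'.+1; first by move: r'r; clear; lia.
  right; exists j; split=> //; rewrite gP ?fj //.
  by rewrite /P colj eqxx fj; move: r'r; clear; lia.
- case/andP=> ne /seq_diagramP[aR|[j [jN fj colj]]]; first by left.
  right; have [Pj|Pj] := boolP (P j); last by exists j; rewrite gN.
  case/andP: (Pj) => /eqP colc fjr.
  have fjE : f j != r by apply: contraNneq ne => fjE; rewrite -fj -colj fjE colc.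
  have [|j' [j'N fj' colj']] := run (f j).+1; first by move: fjr fjE; clear; lia.
  exists j'; rewrite gP; first by rewrite fj' fj colj' -colc.
  by rewrite /P colj' eqxx fj'; move: fjr fjE; clear; lia.
- case=> [aR|[j [jN <- <-]]].
    right; apply/andP; split; last by apply/seq_diagramP; left.
    by apply: contraNneq rNR => <-.
  have [Pj|Pj] := boolP (P j); last first.
    rewrite (gN _ Pj); right; rewrite mem_seq_diagram // andbT.
    apply: contra Pj => /eqP[fj colj]; rewrite /P colj eqxx fj.
    by move: r'r; clear; lia.
  rewrite (gP _ Pj); case/andP: Pj => /eqP colj fjr; rewrite colj.
  have [fE|fE] := eqVneq (f j).-1 r'; [by left; rewrite fE | right].
  have far : r' < (f j).-1 < r by move: fjr fE; clear; lia.
  rewrite fill // andbT; apply/eqP => -[e].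
  by rewrite e ltnn andbF in far.
Qed.

Lemma KD_seq_diagram f E : hook_rows f -> E \in KD (seq_diagram f) -> exists g,
  [/\ hook_rows g, forall i, i < N -> g i <= f i & E = seq_diagram g].
Proof.
move=> vf; move: E; apply: KD_ind => [|E r [g [vg gf ->]]]; first by exists f.
have [h [vh hg ->]] := seq_diagram_move r vg.
by exists h; split=> // i iN; exact: leq_trans (hg i iN) (gf i iN).
Qed.

(* Lowering the last coordinate on which f and g differ is a Kohnert move. *)
Lemma seq_diagram_KD f g : hook_rows f -> hook_rows g ->
  (forall i, i < N -> g i <= f i) -> seq_diagram g \in KD (seq_diagram f).
Proof.
move=> vf [posg decg sdecg].
move eqn: (\sum_(i < N) (f i - g i)) => n; elim: n => [|n IHn] in f vf eqn * => gf.
  rewrite (@seq_diagram_ext g f) ?KD_refl // => i iN.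
  have := eqn; rewrite (bigD1 (Ordinal iN)) //= => /eqP.
  by rewrite addn_eq0 => /andP[/eqP h _]; have := gf i iN; move: h; clear; lia.
have [posf decf sdecf] := vf.
have ex : exists i, (i < N) && (g i < f i).
  apply/not_existsP => h; suff : \sum_(i < N) (f i - g i) = 0 by rewrite eqn.
  apply: big1 => i _; apply/eqP; rewrite subn_eq0 leqNgt; apply/negP => lti.
  by apply: (h i); rewrite ltn_ord.
have ub i : (i < N) && (g i < f i) -> i <= N by case/andP=> /ltnW.
case: (ex_maxnP ex ub) => i /andP[iN gfi] maxi.
have eqj j : i < j -> j < N -> f j = g j.
  move=> ij jN; apply/eqP; rewrite eqn_leq gf // andbT leqNgt; apply/negP => lt_j.
  by have := maxi j; rewrite jN lt_j leqNgt ij => /(_ isT).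
pose h j := if j == i then (f i).-1 else f j.
have hi : h i = (f i).-1 by rewrite /h eqxx.
have hj j : j != i -> h j = f j by rewrite /h => /negbTE->.
have gi : 0 < g i := posg i iN.
have vh : hook_rows h.
  split=> [j jN|j k jk kN|j k jk kN ejk].
  - by rewrite /h; case: ifP => _; [move: gi gfi; clear; lia | exact: posf].
  - have [ji|ji] := eqVneq j i.
      have ki : k != i by rewrite -ji gtn_eqF.
      rewrite ji hi hj // eqj -?ji //; have := decg _ _ jk kN; rewrite ji.
      by move: gfi; clear; lia.
    rewrite (hj _ ji); apply: leq_trans (decf _ _ jk kN).
    by rewrite /h; case: eqP => [->|//]; exact: leq_pred.
  - have [ji|ji] := eqVneq j i.
      have ki : k != i by rewrite -ji gtn_eqF.
      rewrite ji hi hj // eqj -?ji //; have := sdecg _ _ jk kN ejk; rewrite ji.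
      by move: gfi; clear; lia.
    rewrite (hj _ ji); apply: leq_ltn_trans (sdecf _ _ jk kN ejk).
    by rewrite /h; case: eqP => [->|//]; exact: leq_pred.
have gh j : j < N -> g j <= h j.
  move=> jN; have [->|ji] := eqVneq j i; last by rewrite hj // gf.
  by rewrite hi; move: gfi; clear; lia.
have step : seq_diagram h \in KD (seq_diagram f).
  have -> : seq_diagram h = ((f i).-1, col i) |` (seq_diagram f `\ (f i, col i)).
    apply/fsetP => -[a k]; rewrite mem_move_cell; apply/seq_diagramP/orP.
    - case=> [aR|[j [jN <- <-]]].
        right; apply/andP; split; last by apply/seq_diagramP; left.
        by apply/eqP => -[aE kE]; have := colR aR iN; rewrite kE.
      have [->|ji] := eqVneq j i; first by left; rewrite hi.
      right; rewrite hj // mem_seq_diagram // andbT; apply/eqP => -[fE cE].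
      move: ji; rewrite neq_ltn => /orP[ji|ij].
        by have := sdecf _ _ ji iN cE; rewrite fE ltnn.
      by have := sdecf _ _ ij jN (esym cE); rewrite fE ltnn.
    - case=> [/eqP[-> ->]|/andP[ne /seq_diagramP[aR|[j [jN fj colj]]]]].
      + by right; exists i; rewrite hi.
      + by left.
      + right; exists j; split=> //; rewrite hj //.
        by apply: contraNneq ne => ji; rewrite -fj -colj ji.
  (* A listed cell to the right, or one just below in the same column, would have an index after
     [i]. There [f] agrees with [g], so its row is at most [g i < f i], and strictly less within the
     column. *)
  apply: move_cell_KD.
    split=> [|c' lt_c]; first exact: mem_seq_diagram.
    apply/negP => /seq_diagramP[/row1R/=|[j [jN fj colj]]].
      by move: gi gfi; clear; lia.
    have ij : i < j.
      rewrite ltnNge; apply/negP => ji.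
      by have := cols.1 _ _ ji iN; rewrite colj leqNgt lt_c.
    have := decg _ _ ij jN; rewrite -eqj // fj.
    by move: gfi; clear; lia.
  split.
  - by move: gi gfi; clear; lia.
  - apply/negP => /(seq_diagram_col iN)[j [jN fj colj]].
    have ij : i < j.
      rewrite ltnNge leq_eqVlt; apply/negP => /predU1P[ji|ji].
        by move: fj; rewrite ji; move: gi gfi; clear; lia.
      by have := decf _ _ ji iN; rewrite fj; move: gi gfi; clear; lia.
    have := sdecg _ _ ij jN (esym colj); rewrite -eqj // fj.
    by move: gfi; clear; lia.
  - by move=> j; move: gi gfi; clear; lia.
apply: KD_trans step _; apply: IHn => //.
have := eqn; rewrite (bigD1 (Ordinal iN)) //= [in X in _ -> X](bigD1 (Ordinal iN)) //=.
rewrite hi; under [in X in _ -> X]eq_bigr => j ji.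
  rewrite hj; last by move: ji; rewrite -val_eqE.
  over.
by move: gfi (\sum_(_ < N | _) _); clear => gfi s; lia.
Qed.

Lemma seq_diagram_poset f0 : hook_rows f0 ->
  EL_shellable (kohnert_poset (seq_diagram f0)) /\
  shellable (kohnert_poset (seq_diagram f0)).
Proof.
move=> vf0; set T := kohnert_poset _.
(* The coordinates of a diagram are its sequence of rows, unique by [seq_diagram_inj]. *)
have ex (E : T) : exists g, [/\ hook_rows g, forall i, i < N -> g i <= f0 i
    & val E = seq_diagram g] by exact: KD_seq_diagram (valP E).
have [phi hphi] := choice ex.
have phiE (E : T) g : hook_rows g -> val E = seq_diagram g ->
    forall i, i < N -> phi E i = g i.
  by move=> vg Eg; have [v _ e] := hphi E; apply: seq_diagram_inj => //; rewrite -e.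
have phi_le (x y : T) : (x <= y)%O <-> (forall i, i < N -> phi x i <= phi y i).
  have [vx _ ex'] := hphi x; have [vy _ ey] := hphi y.
  split=> [xy i iN|le].
    have : val x \in KD (seq_diagram (phi y)) by rewrite -ey.
    by case/(KD_seq_diagram vy) => g [vg gy /phiE-> //]; exact: gy.
  have : val x \in KD (val y) by rewrite ex' ey seq_diagram_KD.
  by [].
have mk g : hook_rows g -> (forall i, i < N -> g i <= f0 i) ->
    exists z : T, forall i, i < N -> phi z i = g i.
  move=> vg gf0; have gD : seq_diagram g \in KD (seq_diagram f0) by exact: seq_diagram_KD.
  by exists (exist (fun E => E \in KD (seq_diagram f0)) _ gD); exact: phiE.
have phi_raise (x y : T) i : (x <= y)%O -> i < N ->
    (forall j, j < i -> phi x j = phi y j) -> phi x i < phi y i ->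
    exists z : T, forall k, k < N -> phi z k = phi x k + (k == i).
  move=> /phi_le xy iN eqj lti.
  have [[posx decx sdecx] _ _] := hphi x; have [[posy decy sdecy] yf0 _] := hphi y.
  apply: (mk (fun k => phi x k + (k == i))) => [|k kN]; last first.
    apply: leq_trans (yf0 k kN); have := xy k kN; have [->|_] := eqVneq k i.
      by rewrite addn1.
    by rewrite addn0.
  (* At the raised index the bound comes from [y]: earlier entries agree with those of [y], whose
     entry at [i] is at least the raised one. *)
  split=> [k kN|j k jk kN|j k jk kN ejk].
  - by rewrite addn_gt0 posx.
  - have [ki|ki] := eqVneq k i.
      rewrite ki addn1 (eqj j) -?ki // (leq_trans _ (leq_addr _ _)) //.
      by rewrite ki in jk kN *; exact: leq_trans lti (decy _ _ jk kN).
    by rewrite addn0 (leq_trans _ (leq_addr _ _)) // decx.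
  - have [ki|ki] := eqVneq k i.
      rewrite ki addn1 (eqj j) -?ki // (leq_trans _ (leq_addr _ _)) //.
      by rewrite ki in jk kN ejk *; exact: leq_ltn_trans lti (sdecy _ _ jk kN ejk).
    by rewrite addn0 (leq_trans _ (leq_addr _ _)) // sdecx.
have phi_meet (x y : T) : exists2 z : T, (z <= x)%O & (z <= y)%O.
  have [[posx decx sdecx] xf0 _] := hphi x; have [[posy decy sdecy] _ _] := hphi y.
  have [||z hz] := mk (fun k => minn (phi x k) (phi y k)).
  - split=> [k kN|j k jk kN|j k jk kN ejk].
    + by rewrite leq_min posx ?posy.
    + by rewrite leq_min !geq_min decx // decy // orbT.
    + by rewrite leq_min !gtn_min sdecx // sdecy // orbT.
  - by move=> i iN; rewrite geq_min xf0.
  by exists z; apply/phi_le => i iN; rewrite hz // geq_min leqnn ?orbT.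
pose top : T := 
  exist (fun E => E \in KD (seq_diagram f0)) _ (KD_refl (seq_diagram f0)).
have le_top (x : T) : (x <= top)%O := valP x.
split; first exact: (componentwise_EL_shellable phi_le phi_raise phi_meet le_top).
exact: (componentwise_shellable phi_le phi_raise phi_meet le_top).
Qed.

End HookSequences.

(** * Hook diagrams, hooklike diagrams and their sequences *)

Lemma hooklike_seq_diagram D : diagram D -> hooklike D -> exists N col f,
  [/\ hook_columns N col, hook_rows N col f
    & forall R, R `|` D = seq_diagram R N col f].
Proof.
move=> diagD [noasc double].
(* Columns from left to right, and rows from top to bottom within a column. *)
pose le (x y : nat * nat) := (x.2 < y.2) || (x.2 == y.2) && (y.1 <= x.1).
have le_tr : transitive le by move=> x y z; rewrite /le; lia.
have le_total : total le by move=> x y; rewrite /le; lia.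
pose s := sort le (enum_fset D); pose x0 := (0, 0).
have memD x : (x \in s) = (x \in D) by rewrite mem_sort.
have us : uniq s by rewrite sort_uniq fset_uniq.
have srt i j : i < j -> j < size s -> le (nth x0 s i) (nth x0 s j).
  move=> ij jN; apply: (sorted_ltn_nth le_tr) => //; last exact: ltn_trans jN.
  exact: sort_sorted.
have inD i : i < size s -> nth x0 s i \in D by move=> iN; rewrite -memD mem_nth.
have inj i j : i < size s -> j < size s -> i <> j -> nth x0 s i <> nth x0 s j.
  by move=> iN jN ne /eqP; rewrite nth_uniq // => /eqP.
exists (size s), (fun i => (nth x0 s i).2), (fun i => (nth x0 s i).1); split.
- split=> [i j ij jN|i j k iN jN kN ne e].
    by move: ij; rewrite leq_eqVlt => /predU1P[->//|/srt-/(_ jN)]; rewrite /le; lia.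
  by apply: (double _ (nth x0 s j)); rewrite ?inD //; exact: inj.
- split=> [i iN|i j ij jN|i j ij jN e].
  + by have [] := diagD _ (inD _ iN).
  + have := srt i j ij jN; rewrite /le => /orP[|/andP[]//].
    by apply: noasc; rewrite inD // (ltn_trans ij).
  + have := srt i j ij jN; rewrite /le e ltnn eqxx /= leq_eqVlt => /predU1P[e1|//].
    case: (inj i j _ jN); [exact: ltn_trans jN | by move=> ij'; rewrite ij' ltnn in ij |].
    by rewrite [LHS]surjective_pairing [RHS]surjective_pairing e e1.
move=> R; apply/fsetP => -[r c]; apply/fsetUP/seq_diagramP => -[]; try by left.
  by rewrite -memD => /(nthP x0)[i iN e]; right; exists i; rewrite e.
by case=> i [iN <- <-]; right; rewrite -surjective_pairing inD.
Qed.

Lemma hookP r1 r2 (C : {fset nat}) r c :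
  reflect (r = r2 /\ c \in C \/ r1 <= r <= r2 /\ c = \max_(k <- C) k)
          ((r, c) \in hook r1 r2 C).
Proof.
rewrite in_fsetU; apply: (iffP orP) => -[].
- by case/imfsetP => k /= kC [-> ->]; left.
- by case/imfsetP => j /=; rewrite mem_index_iota ltnS => jr [-> ->]; right.
- by case=> -> cC; left; apply/imfsetP; exists c.
- by case=> jr ->; right; apply/imfsetP; exists r; rewrite //= mem_index_iota ltnS.
Qed.

Lemma hook_hooklike r1 r2 (C : {fset nat}) : 0 < r1 -> r1 <= r2 -> C != fset0 ->
  (forall c, c \in C -> 0 < c) -> diagram (hook r1 r2 C) /\ hooklike (hook r1 r2 C).
Proof.
move=> r1_gt0 r12 /fset0Pn[c0 c0C] Cpos.
have cle c r : (r, c) \in hook r1 r2 C -> c <= \max_(k <- C) k.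
  case/hookP => [[_ cC]|[_ ->//]]; exact: (leq_bigmax_seq (F := id) c).
have cmax_gt0 : 0 < \max_(k <- C) k.
  exact: leq_trans (Cpos _ c0C) (leq_bigmax_seq (F := id) c0 c0C isT).
split.
  move=> [r c] /hookP[[-> /Cpos]|[+ ->]] /=; first by lia.
  by case/andP=> r1r _; split=> //; exact: leq_trans r1r.
split=> [[r c] [r' c'] xD yD /=|[r c] [r' c'] [r'' c''] xD yD zD /=].
  case/hookP: (xD) => [[-> _] _|[_ ->]]; last by rewrite ltnNge (cle _ _ yD).
  by case/hookP: yD => [[->]|[/andP[]]].
move=> cc' ne; apply: leq_trans (cle _ _ zD) _.
case/hookP: xD => [[rE _]|[_ ->//]]; case/hookP: yD => [[r'E _]|[_ <-]].
  by case: ne; rewrite rE r'E cc'.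
by rewrite cc'.
Qed.

Lemma seq_diagram0P N col f r c :
  reflect (exists i, [/\ i < N, f i = r & col i = c])
          ((r, c) \in seq_diagram fset0 N col f).
Proof.
by apply: (iffP (seq_diagramP _ _ _ _ _ _)) => [[|//]|]; [rewrite inE | right].
Qed.

Lemma seq_diagram_hooklike N col f : hook_columns N col -> hook_rows N col f ->
  hooklike (seq_diagram fset0 N col f).
Proof.
move=> [mono double] [pos dec sdec].
split=> [[r c] [r' c'] /seq_diagram0P[i [iN <- <-]] |
         [r c] [r' c'] [r'' c''] /seq_diagram0P[i [iN <- <-]]].
  case/seq_diagram0P => j [jN <- <-] /= lt_ij.
  apply: dec => //; rewrite ltnNge; apply/negP => ji.
  by have := mono _ _ ji iN; rewrite leqNgt lt_ij.
case/seq_diagram0P => j [jN <- <-] /seq_diagram0P[k [kN <- <-]] /= e ne.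
by apply: (double i j k) => // ij; apply: ne; rewrite ij.
Qed.

Lemma hook_diagram_hooklike D : hook_diagram D -> hooklike D.
Proof.
move=> [r1 [r2 [C [/andP[r1_gt0 r12] C0 Cpos DH]]]].
have [diagH hookH] := hook_hooklike r1_gt0 r12 C0 Cpos.
have [N [col [f [vc vf HE]]]] := hooklike_seq_diagram diagH hookH.
rewrite -[hook _ _ _]fset0U HE in DH.
have [|||g [vg _ ->]] := KD_seq_diagram _ _ _ vf DH => //.
exact: seq_diagram_hooklike.
Qed.

(** A hook with the same columns and equally many cells in the last one, placed high enough,
    dominates the sequence of [D] entrywise; [seq_diagram_KD] then reaches [D] from it. *)
Lemma hooklike_hook_diagram D : diagram D -> D != fset0 -> hooklike D ->
  hook_diagram D.
Proof.
move=> diagD /fset0Pn[y yD] hookD.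
have [N [col [f [vc vf DE]]]] := hooklike_seq_diagram diagD hookD.
have {}DE : D = seq_diagram fset0 N col f by rewrite -DE fset0U.
have colD i : i < N -> (f i, col i) \in D.
  by move=> iN; rewrite DE; apply/seq_diagram0P; exists i.
have N_gt0 : 0 < N.
  move: yD; rewrite DE; case: y => r c /seq_diagram0P[i [iN _ _]].
  exact: leq_ltn_trans iN.
have lastN : N.-1 < N by rewrite prednK.
have [mono double] := vc; have [posf decf _] := vf.
pose m := col N.-1.
have le_m i : i < N -> col i <= m by move=> iN; apply: mono => //; rewrite -ltnS prednK.
have [|i0 [[i0N coli0] mini0]] := @ex_min_nat (fun i => i < N /\ col i = m).
  by exists N.-1.
have col_ge i : i0 <= i -> i < N -> col i = m.
  by move=> ii iN; apply/eqP; rewrite eqn_leq le_m //= -coli0 mono.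
have col_lt i j : i < j -> j < N -> col i = col j -> i0 <= i.
  move=> ij jN e; have iN := ltn_trans ij jN; apply: mini0; split=> //.
  apply/eqP; rewrite eqn_leq le_m //=; apply: (double i j N.-1) => //.
  by move=> e'; rewrite e' ltnn in ij.
(* Index [i0] starts the last column, whose [N - i0] cells fill rows [r1] to [r2]. The summand [N]
   keeps even the lowest of them above [f 0], the largest entry of [f]. *)
pose r2 := f 0 + N; pose r1 := r2 - (N.-1 - i0).
pose g i := if i < i0 then r2 else r2 - (i - i0).
pose C : {fset nat} := [fset col i | i in iota 0 N].
have CP c : reflect (exists2 i, i < N & col i = c) (c \in C).
  apply: (iffP idP) => [/imfsetP[i /=]|[i iN <-]].
    by rewrite mem_iota => iN ->; exists i.
  by apply/imfsetP; exists i; rewrite //= mem_iota.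
have f_le i : i < N -> f i <= f 0.
  by case: i => // i iN; exact: decf.
have vg : hook_rows N col g.
  split=> [i iN|i j ij jN|i j ij jN e].
  - by rewrite /g /r2; case: ifP => _; move: iN; clear; lia.
  - rewrite /g; case: ifP; case: ifP; move: ij; clear; lia.
  - have i0i := col_lt _ _ ij jN e; rewrite /g /r2.
    by case: ifP; case: ifP; move: i0i ij jN; clear; lia.
have fg i : i < N -> f i <= g i.
  move=> iN; apply: leq_trans (f_le i iN) _; rewrite /g /r2.
  by case: ifP => _; move: iN; clear; lia.
have maxC : \max_(k <- C) k = m.
  apply/eqP; rewrite eqn_leq; apply/andP; split.
    by apply/bigmax_leqP_seq => k /CP[i iN <-] _; exact: le_m.
  by apply: (leq_bigmax_seq (F := id) m) => //; apply/CP; exists N.-1.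
exists r1, r2, C; split.
- by rewrite /r1 /r2; move: N_gt0; clear; lia.
- by apply/fset0Pn; exists m; apply/CP; exists N.-1.
- by move=> c /CP[i iN <-]; have [] := diagD _ (colD i iN).
have -> : hook r1 r2 C = seq_diagram fset0 N col g.
  apply/fsetP => -[r c]; apply/hookP/seq_diagram0P; rewrite maxC.
  - case=> [[-> /CP[i iN <-]]|[rr ->]].
      have [ii0|i0i] := ltnP i i0; first by exists i; rewrite /g ii0.
      by exists i0; rewrite /g ltnn subnn subn0 coli0 col_ge.
    have rN : i0 + (r2 - r) < N by move: rr i0N; rewrite /r1; clear; lia.
    exists (i0 + (r2 - r)); rewrite col_ge ?leq_addr //; split=> //.
    by rewrite /g ltnNge leq_addr /=; move: rr; clear; lia.
  - case=> i [iN <- <-].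
    rewrite /g; have [ii0|i0i] := ltnP i i0.
      by left; split=> //; apply/CP; exists i.
    right; rewrite col_ge //; split=> //.
    by rewrite /r1 /r2; move: i0i iN; clear; lia.
by rewrite DE; apply: seq_diagram_KD.
Qed.

Lemma hooklike_or_empty D : diagram D ->
  hooklike D <-> (D = fset0 \/ hook_diagram D).
Proof.
move=> diagD; split=> [hookD|[->|/hook_diagram_hooklike//]].
  by have [->|D0] := eqVneq D fset0; [left | right; exact: hooklike_hook_diagram].
by split=> x; rewrite inE.
Qed.

(** * Assembling the equivalences *)

Lemma hooklike_poset R D : diagram D -> hooklike D ->
  (forall x, x \in R -> x.1 = 1) -> (forall x y, x \in R -> y \in D -> y.2 <> x.2) ->
  EL_shellable (kohnert_poset (R `|` D)) /\ shellable (kohnert_poset (R `|` D)).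
Proof.
move=> diagD hookD row1R colR.
have [N [col [f [vc vf DE]]]] := hooklike_seq_diagram diagD hookD.
rewrite DE; apply: seq_diagram_poset => // x i xR iN; apply: (colR x (f i, col i)) => //.
rewrite -[D]fset0U DE; by apply/seq_diagram0P; exists i.
Qed.

(** A hexagon refutes both forms of shellability at once, so the three statements hold together or
    fail together. *)
Lemma shellability_dichotomy D (hook : Prop) :
  (hook -> EL_shellable (kohnert_poset D) /\ shellable (kohnert_poset D)) ->
  (~ hook -> has_hexagon D) ->
  (shellable (kohnert_poset D) <-> EL_shellable (kohnert_poset D)) /\
  (EL_shellable (kohnert_poset D) <-> hook).
Proof.
move=> yes no; have [h|nh] := pselect hook; first by have [] := yes h.
have [x [a [b [a' [b' [y hex]]]]]] := no nh.
by have := hexagon_not_EL hex; have := hexagon_not_shellable hex.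
Qed.

Local Open Scope fset_scope.

Theorem theorem4p3 :
  (forall D : cells, diagram D ->
     (forall c : nat, column_of D c != fset0 -> #|` column_of D c| = 1) ->
     let D' := D `\` row_of D 1 in
     (shellable (kohnert_poset D) <-> EL_shellable (kohnert_poset D)) /\
     (EL_shellable (kohnert_poset D) <-> (D' = fset0 \/ hook_diagram D')))
  /\
  (forall D : cells, diagram D ->
     row_of D 1 = fset0 -> row_of D 2 = fset0 ->
     (shellable (kohnert_poset D) <-> EL_shellable (kohnert_poset D)) /\
     (EL_shellable (kohnert_poset D) <-> (D = fset0 \/ hook_diagram D))).
Proof.
split=> D diagD => [single D'|row1 row2].
  have diagD' : diagram D' by move=> x /fsetDP[/diagD].
  have one r r' c : (r, c) \in D -> (r', c) \in D -> r = r'.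
    move=> rD r'D; have rc : (r, c) \in column_of D c by rewrite !inE rD /=.
    have col0 : column_of D c != fset0 by apply/fset0Pn; exists (r, c).
    have /eqP/cardfs1P[x colE] := single c col0.
    have : (r', c) \in column_of D c by rewrite !inE r'D /=.
    by move: rc; rewrite colE !in_fset1 => /eqP<- /eqP[].
  have rowD r c : (r, c) \in row_of D 1 -> (r, c) \in D /\ r = 1.
    by rewrite !inE => /andP[rD /eqP].
  have [||eq1 eq2] := @shellability_dichotomy D (hooklike D').
  (* The cells of row 1 form the immobile part [R]; having one cell per column keeps their columns
     apart from those of [D']. *)
  - move=> hookD'; have DE : row_of D 1 `|` D' = D.
      by apply/fsetP => x; rewrite !inE; case: (x \in D); case: (x.1 == 1).
    rewrite -DE; apply: hooklike_poset => //.
    + by move=> [r c] /rowD[].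
    + move=> [r c] [r' c'] xR /fsetDP[r'D r'1] /= e; have [rD _] := rowD _ _ xR.
      by case/negP: r'1; rewrite e in r'D *; rewrite (one _ _ _ r'D rD).
  - exact: not_hooklike_hexagon_single.
  by split=> //; apply: (iff_trans eq2); exact: hooklike_or_empty.
have rows r c : (r, c) \in D -> 2 < r.
  move=> rD; have [/= r0 _] := diagD _ rD.
  have r1 : r != 1.
    by apply/eqP => r1; have := row_of_neq0 rD; rewrite r1 row1 eqxx.
  have r2 : r != 2.
    by apply/eqP => r2; have := row_of_neq0 rD; rewrite r2 row2 eqxx.
  by move: r0 r1 r2; clear; lia.
have [||eq1 eq2] := @shellability_dichotomy D (hooklike D).
- move=> hookD; rewrite -[D]fset0U; apply: hooklike_poset => //.
- exact: not_hooklike_hexagon_free_rows.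
by split=> //; apply: (iff_trans eq2); exact: hooklike_or_empty.
Qed.
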